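(* In the setting described in the context, let $\mathcal{X}_t(\{\bm{x}_0\})$ be the integrator reach set with time-varying input range $[u_{\min}(s),u_{\max}(s)]$, $s\in[0,t]$. Then every boundary point $\bm{x}^{\rm bdy}\in\partial\mathcal{X}_t(\{\bm{x}_0\})$ admits the parameterization, for some $\bm{\sigma}=(\sigma_1,\dots,\sigma_{n-1})\in\mathcal{W}_t$ and some choice of overall sign $\epsilon\in\{+1,-1\}$, $$\bm{x}^{\rm bdy}(\bm{\sigma})=\bm{\chi}(t,\bm{x}_0)+\int_0^t\nu(s)\bm{\xi}(t-s)\,{\rm d}s+\epsilon\sum_{i=1}^{n}(-1)^{i-1}\int_{\sigma_{i-1}}^{\sigma_i}\mu(s)\bm{\xi}(t-s)\,{\rm d}s,$$ with the convention $\sigma_0:=0$, $\sigma_n:=t$.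
   Context: Let $\bm{A}\in\mathbb{R}^{n\times n}$, $\bm{b}\in\mathbb{R}^n$ with $(\bm{A},\bm{b})$ controllable and $\bm{A}$ having $n$ distinct eigenvalues; let $v_{\min}\le v_{\max}$ be constants, $\bm{z}_0\in\mathbb{R}^n$, $t>0$, and $\bm{x}_0:=\bm{M}\bm{z}_0$. Here $\bm{C}=(\bm{b},\bm{A}\bm{b},\dots,\bm{A}^{n-1}\bm{b})$, $\bm{q}^\top$ is the last row of $\bm{C}^{-1}$, $\bm{M}$ has rows $\bm{q}^\top,\bm{q}^\top\bm{A},\dots,\bm{q}^\top\bm{A}^{n-1}$; $\bm{c}=(c_0,\dots,c_{n-1})^\top$ are the coefficients of the characteristic polynomial $\lambda^n+c_{n-1}\lambda^{n-1}+\dots+c_0$ of $\bm{A}$; $\bm{A}_{\rm con}=\bm{M}\bm{A}\bm{M}^{-1}$ is the companion matrix with first $n-1$ rows $(\bm{0}\ \bm{I}_{n-1})$ and last row $-\bm{c}^\top$; $\bm{b}_{\rm con}=(0,\dots,0,1)^\top$; $\bm{A}_{\rm int}$ has first $n-1$ rows $(\bm{0}\ \bm{I}_{n-1})$ and last row zero. For $0\le s\le t$, with $f(\tau)=\langle\bm{c},e^{(s-\tau)\bm{A}_{\rm con}}\bm{b}_{\rm con}\rangle$ and $I(v)=v(s)-\int_0^s f(\tau)v(\tau)\,{\rm d}\tau$, let $I_{\min}(s),I_{\max}(s)$ be the inf and sup of $I(v)$ over $v\in C([0,s])$ with $v_{\min}\le v\le v_{\max}$, and $u_{\min}(s)=-\langle\bm{c},e^{s\bm{A}_{\rm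 con}}\bm{M}\bm{z}_0\rangle+I_{\min}(s)$, $u_{\max}(s)=-\langle\bm{c},e^{s\bm{A}_{\rm con}}\bm{M}\bm{z}_0\rangle+I_{\max}(s)$. The integrator reach set $\mathcal{X}_t(\{\bm{x}_0\})$ is the set of $\bm{x}(t)$ with $\dot{\bm{x}}=\bm{A}_{\rm int}\bm{x}+\bm{b}_{\rm con}u$, $\bm{x}(0)=\bm{x}_0$, $u\in C([0,t])$, $u_{\min}(s)\le u(s)\le u_{\max}(s)$ for all $s$. Define $\mu(s):=(u_{\max}(s)-u_{\min}(s))/2$, $\nu(s):=(u_{\max}(s)+u_{\min}(s))/2$, $\bm{\xi}(s):=\big(\tfrac{s^{n-1}}{(n-1)!},\tfrac{s^{n-2}}{(n-2)!},\dots,s,1\big)^\top$, and $\bm{\chi}(t,\bm{x}_0)\in\mathbb{R}^n$ componentwise by $\chi_k=\sum_{\ell=k}^{n}\frac{t^{\ell-k}}{(\ell-k)!}x_{\ell0}$, $k=1,\dots,n$, where $x_{\ell 0}$ is the $\ell$-th component of $\bm{x}_0$. The Weyl chamber is $\mathcal{W}_t:=\{\bm{\sigma}\in\mathbb{R}^{n-1}\mid 0\le\sigma_1\le\dots\le\sigma_{n-1}\le t\}$. *)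

(* Defs.v *)
From HB Require Import structures.
From mathcomp Require Import all_boot all_order all_algebra.
From mathcomp Require Import all_classical all_reals all_analysis.
From mathcomp Require Import complex.
Set Implicit Arguments. Unset Strict Implicit. Unset Printing Implicit Defensive.
Import Order.TTheory GRing.Theory Num.Theory.
Import numFieldNormedType.Exports.
Local Open Scope classical_set_scope.
Local Open Scope ring_scope.

Section Defs.
Variable R : realType.

Definition expmx (m : nat) (A : 'M[R]_m) : 'M[R]_m :=
  \matrix_(i, j) limn (series (fun k => (A ^+ k) i j / (k`!)%:R)).

Definition ctrb (m : nat) (A : 'M[R]_m) (b : 'cV[R]_m) : 'M[R]_m :=
  \matrix_(i, j) ((A ^+ j *m b) i 0).

Definition controllable (m : nat) (A : 'M[R]_m) (b : 'cV[R]_m) : Prop :=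
  \rank (ctrb A b) = m.

Definition distinct_eigenvalues (m : nat) (A : 'M[R]_m) : Prop :=
  exists lam : m.-tuple R[i],
    uniq lam /\
    map_poly (fun x : R => Complex x 0) (char_poly A) = \prod_(l <- lam) ('X - l%:P).

Definition qrow (n : nat) (A : 'M[R]_n.+1) (b : 'cV[R]_n.+1) : 'rV[R]_n.+1 :=
  row ord_max (invmx (ctrb A b)).

Definition Mmat (n : nat) (A : 'M[R]_n.+1) (b : 'cV[R]_n.+1) : 'M[R]_n.+1 :=
  \matrix_(i, j) ((qrow A b *m A ^+ i) 0 j).

Definition ccoef (m : nat) (A : 'M[R]_m) : 'cV[R]_m :=
  \col_(k < m) (char_poly A)`_k.

Definition Acon (n : nat) (A : 'M[R]_n.+1) : 'M[R]_n.+1 :=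
  \matrix_(i, j) (if i == ord_max then - (ccoef A) j 0
                  else ((j : nat) == i.+1)%:R).

Definition bcon (n : nat) : 'cV[R]_n.+1 := \col_(i < n.+1) ((i == ord_max)%:R).

Definition Aint (n : nat) : 'M[R]_n.+1 :=
  \matrix_(i, j) (((j : nat) == i.+1)%:R).

Definition dotv (m : nat) (x y : 'cV[R]_m) : R := (x^T *m y) 0 0.

Definition Rint (a b : R) (f : R -> R) : R :=
  Rintegral (@lebesgue_measure R) `[a, b] f.

Definition fker (n : nat) (A : 'M[R]_n.+1) (s tau : R) : R :=
  dotv (ccoef A) (expmx ((s - tau) *: Acon A) *m bcon n).

Definition admissible (vmin vmax s : R) (v : R -> R) : Prop :=
  {within `[0, s], continuous v} /\
  (forall tau, 0 <= tau <= s -> vmin <= v tau <= vmax).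

Definition Ifun (n : nat) (A : 'M[R]_n.+1) (s : R) (v : R -> R) : R :=
  v s - Rint 0 s (fun tau => fker A s tau * v tau).

Definition Iset (n : nat) (A : 'M[R]_n.+1) (vmin vmax s : R) : set R :=
  [set Ifun A s v | v in admissible vmin vmax s].

Definition Imin n A vmin vmax s : R := inf (@Iset n A vmin vmax s).
Definition Imax n A vmin vmax s : R := sup (@Iset n A vmin vmax s).

Definition umin (n : nat) (A : 'M[R]_n.+1) (b : 'cV[R]_n.+1)
  (vmin vmax : R) (z0 : 'cV[R]_n.+1) (s : R) : R :=
  - dotv (ccoef A) (expmx (s *: Acon A) *m (Mmat A b *m z0))
  + Imin A vmin vmax s.

Definition umax (n : nat) (A : 'M[R]_n.+1) (b : 'cV[R]_n.+1)
  (vmin vmax : R) (z0 : 'cV[R]_n.+1) (s : R) : R :=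
  - dotv (ccoef A) (expmx (s *: Acon A) *m (Mmat A b *m z0))
  + Imax A vmin vmax s.

Definition reach_set (n : nat) (ulo uhi : R -> R) (t : R)
  (x0 : 'cV[R]_n.+1) : set 'cV[R]_n.+1 :=
  [set y | exists (u : R -> R) (x : R -> 'cV[R]_n.+1),
     [/\ {within `[0, t], continuous u},
         (forall s, 0 <= s <= t -> ulo s <= u s <= uhi s),
         {within `[0, t], continuous x} /\ x 0 = x0,
         (forall s, 0 < s < t -> is_derive s (1 : R) x (Aint n *m x s + u s *: bcon n))
       & y = x t]].

Definition boundary (T : topologicalType) (X : set T) : set T :=
  closure X `\` interior X.

(* xi(s) = (s^{m-1}/(m-1)!, ..., s, 1)^T, m = n.+1 (0-indexed component k
   is s^(n-k)/(n-k)!) *)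
Definition xi (n : nat) (s : R) : 'cV[R]_n.+1 :=
  \col_(k < n.+1) (s ^+ (n - k) / ((n - k)`!)%:R).

Definition chi (n : nat) (t : R) (x0 : 'cV[R]_n.+1) : 'cV[R]_n.+1 :=
  \col_(k < n.+1) \sum_(l < n.+1 | (k <= l)%N)
      (t ^+ (l - k) / ((l - k)`!)%:R * x0 l 0).

Definition weyl (n : nat) (t : R) : set ('I_n -> R) :=
  [set sg | (forall i : 'I_n, 0 <= sg i <= t) /\
            (forall i j : 'I_n, (i <= j)%N -> sg i <= sg j)].

(* sigma_i for i = 0..m with sigma_0 = 0, sigma_m = t, sigma_i = sg (i-1) *)
Definition sigext (n : nat) (t : R) (sg : 'I_n -> R) (i : nat) : R :=
  if i is j.+1 then (if @insub _ (fun k => (k < n)%N) 'I_n j is Some k then sg k else t)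
  else 0.

Definition Rintv (n : nat) (a b : R) (g : R -> 'cV[R]_n.+1) : 'cV[R]_n.+1 :=
  \col_(k < n.+1) Rint a b (fun s => g s k 0).

End Defs.

(* Main.v *)
Require Import Defs.
From HB Require Import structures.
From mathcomp Require Import all_boot all_order all_algebra polyrcf.
From mathcomp Require Import all_classical all_reals all_analysis.
From mathcomp Require Import measurable_realfun ring lra.
Import Order.TTheory GRing.Theory Num.Theory.
Import numFieldNormedType.Exports.
Local Open Scope classical_set_scope.
Local Open Scope ring_scope.
Set Implicit Arguments. Unset Strict Implicit. Unset Printing Implicit Defensive.

(** Iterated integration gives [x(t) = chi + int_0^t u(s) xi(t-s) ds], so the reach set
is convex and a boundary point [xb] has a supporting functional [eta <> 0].  The
switching function [p(s) = <eta, xi(t-s)>] is a nonzero polynomial of degree at most [n],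
so its sign alternates on the segments cut out by [n] switching times.  The bang-bang
input [u* = nu + mu sgn p] is not continuous, but the admissible inputs
[nu + mu p/(|p|+d)] show that its endpoint [x*] satisfies [<eta, x*> <= <eta, xb>].  For
an admissible [u], [<eta, x* - x(u)> = int |u* - u| |p|]; as [p] vanishes almost nowhere,
[int |u* - u|] is small when this is, so [eta] strongly exposes [x*] and [xb = x*].
Continuity of [u_min] and [u_max] comes from reversing time in the integral defining
[I(v)]. *)

(** * Supporting hyperplanes of convex sets *)

Lemma convex_setP (R : numDomainType) (V : lmodType R) (C : set (convex_lmodType V)) :
  convex_set C <-> forall (x y : V) a b, C x -> C y -> 0 <= a -> 0 <= b -> a + b = 1 ->
    C (a *: x + b *: y).
Proof.
split=> [cC x y a b Cx Cy a0 b0 ab|cC x y l /set_mem Cx /set_mem Cy].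
  have a1 : a <= 1 by rewrite -ab lerDl.
  have /(_ (Itv01 a0 a1)) := cC x y _ (mem_set Cx) (mem_set Cy).
  by have -> : b = 1 - a; [rewrite -ab addrAC subrr add0r|rewrite inE].
by rewrite inE; apply: cC; rewrite ?subr_ge0// addrC subrK.
Qed.

Lemma convex_set_sum (R : numFieldType) (V : lmodType R) (C : set (convex_lmodType V))
    (I : eqType) (r : seq I) (a : I -> R) (x : I -> V) : convex_set C ->
  (forall i, 0 <= a i) -> \sum_(i <- r) a i = 1 -> (forall i, C (x i)) ->
  C (\sum_(i <- r) a i *: x i).
Proof.
move=> /convex_setP cC + + Cx; elim: r a => [|i r IH] a a0.
  by rewrite big_nil => /esym/eqP; rewrite oner_eq0.
rewrite !big_cons; set s := \sum_(j <- r) a j => ais.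
have s0 : 0 <= s by exact: sumr_ge0.
have [sE|sN] := eqVneq s 0.
  have -> : \sum_(j <- r) a j *: x j = 0.
    move/eqP: sE; rewrite psumr_eq0// => /allP/= ar; apply: big1_seq => j /ar/eqP ->.
    by rewrite scale0r.
  by move: ais; rewrite sE !addr0 => ->; rewrite scale1r.
have -> : \sum_(j <- r) a j *: x j = s *: \sum_(j <- r) (a j / s) *: x j.
  by rewrite scaler_sumr; apply: eq_bigr => j _; rewrite scalerA mulrCA divff ?mulr1.
apply: cC => //; apply: IH => [j|]; first by rewrite divr_ge0.
by rewrite -mulr_suml divff.
Qed.

Lemma algebraic_interior_sub (R : realType) (n : nat) (C : set 'cV[R]_n.+1)
    (x : 'cV[R]_n.+1) : convex_set C ->
  (forall d, exists2 e : R, 0 < e & C (x + e *: d)) -> interior C x.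
Proof.
move=> cC Cray; have /convex_setP cC' := cC.
have Cseg d : exists2 e : R, 0 < e & forall a, `|a| <= e -> C (x + a *: d).
  have [e e0 Ce] := Cray d; have [f f0 Cf] := Cray (- d).
  exists (Num.min e f) => [|a]; first by rewrite lt_min e0.
  rewrite le_min !ler_norml => /andP[/andP[_ ae] /andP[fa _]].
  have ef0 : 0 < e + f by rewrite addr_gt0.
  have -> : x + a *: d =
      ((f + a) / (e + f)) *: (x + e *: d) + ((e - a) / (e + f)) *: (x + f *: - d).
    by apply/matrixP => i j; rewrite !mxE; field; rewrite gt_eqF.
  by apply: cC'; rewrite ?divr_ge0//; [lra.. | field; rewrite gt_eqF].
have /choice[e Ce] : forall i : 'I_n.+1, exists e : R,
    0 < e /\ forall a, `|a| <= e -> C (x + a *: delta_mx i 0).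
  by move=> i; have [e] := Cseg (delta_mx i 0); exists e.
pose r := \big[Num.min/1]_i e i.
have r0 : 0 < r by apply/bigmin_gtP; split=> // i _; have [] := Ce i.
(* The ball of radius [r / n.+1] lies in the convex hull of the points
   [x +- e i *: delta_mx i 0]. *)
apply/nbhs_ballP; exists (r / n.+1%:R) => [|y xy] /=; first by rewrite divr_gt0.
have -> : y = \sum_i n.+1%:R^-1 *: (x + (n.+1%:R * (y i 0 - x i 0)) *: delta_mx i 0).
  apply/colP => j; rewrite summxE (eq_bigr (fun i => n.+1%:R^-1 * x j 0 +
    (y i 0 - x i 0) * (j == i)%:R)) => [|i _]; last first.
    by rewrite !mxE eqxx andbT; field; rewrite addrC natr1 pnatr_eq0.
  rewrite big_split /= sumr_const card_ord -[_ *+ _]mulr_natl mulrA divff// mul1r.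
  rewrite (bigD1 j)//= eqxx big1 => [|i ij]; last by rewrite eq_sym (negbTE ij) mulr0.
  by rewrite mulr1 addr0 subrKC.
apply: convex_set_sum => // [|i].
  by rewrite sumr_const card_ord -[_ *+ _]mulr_natl divff.
have [_] := Ce i; apply; apply: (@le_trans _ _ r); last exact: bigmin_le_cond.
have [_ /(_ i 0)/ltW] := xy; rewrite /ball /= distrC ler_pdivlMr ?ltr0n//.
by rewrite normrM normr_nat mulrC.
Qed.

Section DotProduct.
Variables (R : realType) (m : nat).
Implicit Types x y : 'cV[R]_m.

Lemma dotvE x y : dotv x y = \sum_i x i 0 * y i 0.
Proof. by rewrite /dotv mxE; apply: eq_bigr => i _; rewrite mxE. Qed.

Fact dotv_is_scalar x : scalar (dotv x).
Proof. by move=> a y z; rewrite /dotv mulmxDr -scalemxAr !mxE. Qed.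

HB.instance Definition _ x :=
  GRing.isLinear.Build R 'cV[R]_m R *%R (dotv x) (dotv_is_scalar x).

Lemma dotv_col_mx (a : R) x (y : 'cV[R]_(1 + m)) :
  dotv (col_mx a%:M x) y = a * y 0 0 + dotv x (dsubmx y).
Proof.
rewrite /dotv -{1}(vsubmxK y) tr_col_mx mul_row_col tr_scalar_mx mul_scalar_mx !mxE.
by rewrite (_ : lshift m 0 = 0)//; apply/val_inj.
Qed.

End DotProduct.

Lemma convex_zero_crossing (R : realFieldType) (V : lmodType R)
    (C : set (convex_lmodType V)) (f : {scalar V}) (x y : V) :
  convex_set C -> C x -> C y -> f y < 0 < f x ->
  let z := (f x - f y)^-1 *: (f x *: y - f y *: x) in C z /\ f z = 0.
Proof.
move=> /convex_setP cC Cx Cy /andP[fy fx] z; have fxy : 0 < f x - f y by lra.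
split; last by rewrite /z scalarZ linearB !scalarZ [f x * _]mulrC subrr mulr0.
rewrite /z scalerBr !scalerA -scaleNr; apply: cC => //.
- by rewrite mulr_ge0 ?invr_ge0 ?ltW.
- by rewrite oppr_ge0 pmulr_rle0 ?invr_gt0 ?ltW.
- by rewrite -mulrBr mulVf ?gt_eqF.
Qed.

(* The multiplier is the supremum of the slopes [- g x / f x] over the points of [C]
   with [f x > 0]. *)
Lemma convex_multiplier (R : realType) (V : lmodType R) (C : set (convex_lmodType V))
    (f g : {scalar V}) (xp xn : V) :
  convex_set C -> C xp -> 0 < f xp -> C xn -> f xn < 0 ->
  (forall x, C x -> f x = 0 -> 0 <= g x) ->
  exists a, forall x, C x -> 0 <= a * f x + g x.
Proof.
move=> cC Cxp fxp Cxn fxn g0.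
have slope x y : C x -> 0 < f x -> C y -> f y < 0 -> - g x / f x <= - g y / f y.
  move=> Cx fx Cy fy.
  have [|/g0/[apply]] := convex_zero_crossing (f := f) cC Cx Cy; first by rewrite fy.
  rewrite scalarZ linearB !scalarZ pmulr_rge0 ?invr_gt0; last by lra.
  by move=> cross; rewrite ler_pdivrMr// mulrAC ler_ndivlMr//; lra.
pose S := [set - g x / f x | x in [set x | C x /\ 0 < f x]].
have supS : has_sup S.
  split; first by exists (- g xp / f xp), xp.
  by exists (- g xn / f xn) => _ [x [Cx fx] <-]; exact: slope.
exists (sup S) => x Cx; have [fx|fx|fx] := ltgtP (f x) 0.
- have : sup S <= - g x / f x.
    by apply: ge_sup supS.1 _ => _ [y [Cy fy] <-]; exact: slope.
  by rewrite ler_ndivlMr//; lra.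
- have : - g x / f x <= sup S by apply: sup_ubound; [exact: supS.2|exists x].
  by rewrite ler_pdivrMr//; lra.
- by rewrite fx mulr0 add0r g0.
Qed.

Lemma col_mx_dsubmx (R : realType) (m : nat) (x : 'cV[R]_(1 + m)) :
  x 0 0 = 0 -> col_mx 0 (dsubmx x) = x.
Proof.
move=> x0; rewrite -[RHS]vsubmxK; congr col_mx; apply/matrixP => i j.
by rewrite !ord1 !mxE -x0; congr (x _ _); apply/val_inj.
Qed.

Lemma convex_slice (R : realType) (m : nat) (C : set 'cV[R]_(1 + m)) :
  convex_set C -> convex_set [set y : 'cV[R]_m | C (col_mx 0 y)].
Proof.
move=> /convex_setP cC; apply/convex_setP => u v a b Cu Cv a0 b0 ab.
rewrite /= (_ : col_mx _ _ = a *: col_mx 0 u + b *: col_mx 0 v); first exact: cC.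
by rewrite !scale_col_mx add_col_mx !scaler0 addr0.
Qed.

(* Induction on the dimension: a functional that is nonnegative on the slice [x 0 0 = 0]
   extends to all of [C]. *)
Lemma convex_separation0 (R : realType) (m : nat) (C : set 'cV[R]_m) :
  convex_set C -> C !=set0 -> ~ C 0 ->
  exists2 eta : 'cV[R]_m, eta != 0 & forall x, C x -> 0 <= dotv eta x.
Proof.
elim: m C => [|m IH] => [C _ [z Cz] []|]; first by rewrite -(flatmx0 z).
rewrite -[m.+1]/(1 + m)%N => C cC _ C0.
pose e0 : 'cV[R]_(1 + m) := col_mx 1%:M 0.
have e0E (x : 'cV[R]_(1 + m)) : dotv e0 x = x 0 0.
  by rewrite dotv_col_mx /dotv trmx0 mul0mx mxE mul1r addr0.
have e0_neq0 : e0 != 0 by rewrite col_mx_eq0; apply/nandP; left; exact: oner_neq0.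
have [xge0|/existsNP[xn /not_implyP[Cxn /negP]]] :=
  pselect (forall x, C x -> 0 <= dotv e0 x); first by exists e0.
rewrite -ltNge => xn0.
have [xle0|/existsNP[xp /not_implyP[Cxp /negP]]] :=
  pselect (forall x, C x -> dotv e0 x <= 0).
  exists (- e0) => [|x Cx]; first by rewrite oppr_eq0.
  by rewrite /dotv linearN mulNmx mxE oppr_ge0; exact: xle0.
rewrite -ltNge => xp0.
have [|Cy y0] := convex_zero_crossing (f := dotv e0) cC Cxp Cxn.
  by rewrite /= xn0.
have [||eta eta0 etaC] := IH _ (convex_slice cC).
- set y := _ *: _ in Cy y0; exists (dsubmx y).
  by rewrite /= col_mx_dsubmx// -e0E.
- by rewrite /= col_mx0.
have [x Cx /= x0|a aC] :=
  convex_multiplier (g := dotv (col_mx 0%:M eta)) cC Cxp xp0 Cxn xn0.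
  rewrite dotv_col_mx mul0r add0r; apply: etaC.
  by rewrite /= col_mx_dsubmx// -e0E.
exists (col_mx a%:M eta) => [|x /aC]; first by rewrite col_mx_eq0 negb_and eta0 orbT.
by rewrite /= e0E !dotv_col_mx mul0r add0r.
Qed.

Lemma supporting_hyperplane (R : realType) (n : nat) (C : set 'cV[R]_n.+1)
    (x : 'cV[R]_n.+1) : convex_set C -> C !=set0 -> ~ interior C x ->
  exists2 eta : 'cV[R]_n.+1, eta != 0 & forall y, C y -> dotv eta y <= dotv eta x.
Proof.
move=> cC [z Cz] xint.
have [d Cray] : exists d, forall e : R, 0 < e -> ~ C (x + e *: d).
  apply: contra_notP xint => /forallNP ray; apply: algebraic_interior_sub cC _ => d.
  by have /existsNP[e /not_implyP[e0 /contrapT]] := ray d; exists e.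
(* Separate [0] from [x + ]0, +oo[ d - C], then let the multiple of [d] vanish. *)
pose D := [set v | exists e y, [/\ 0 < e, C y & v = x + e *: d - y]].
have [|||eta eta0 etaD] := @convex_separation0 _ _ D.
- apply/convex_setP => _ _ a b [e [y [e0 Cy ->]]] [f [w [f0 Cw ->]]] a0 b0 ab.
  exists (a * e + b * f), (a *: y + b *: w); split.
  + have [az|aN] := eqVneq a 0; first by rewrite az mul0r add0r mulr_gt0//; lra.
    by rewrite ltr_wpDr ?mulr_gt0 ?mulr_ge0 ?(ltW f0)// lt_def aN.
  + by move/convex_setP : cC; apply.
  + by apply/matrixP => i j; rewrite !mxE (_ : b = 1 - a); [ring|lra].
- by exists (x + 1 *: d - z), 1, z.
- by move=> [e [y [e0 Cy /esym/subr0_eq xdy]]]; apply: (Cray e); rewrite ?xdy.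
exists eta => // y Cy; apply/ler_addgt0Pr => e e0.
have w0 : 0 < `|dotv eta d| + 1 by rewrite ltr_wpDl.
have /etaD : D (x + (e / (`|dotv eta d| + 1)) *: d - y).
  by exists (e / (`|dotv eta d| + 1)), y; split=> //; exact: divr_gt0.
rewrite linearB linearD scalarZ /= subr_ge0 => /le_trans; apply.
rewrite lerD2l mulrAC ler_pdivrMr// ler_pM2l//.
by rewrite (le_trans (ler_norm _))// lerDl.
Qed.

(** * Sign changes of a polynomial *)

Lemma poly_factor_roots_in (R : idomainType) (A : set R) (p : {poly R}) : p != 0 ->
  exists (rs : seq R) (q : {poly R}), [/\ p = q * \prod_(r <- rs) ('X - r%:P),
    (size rs < size p)%N, {in rs, forall r, A r} & forall x, A x -> ~~ root q x].
Proof.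
have [m] := ubnP (size p); elim: m p => // m IH p /ltnSE sp p0.
have [[x [Ax /factor_theorem[q pE]]]|noroot] :=
  pselect (exists x, A x /\ root p x); last first.
  exists [::], p; split; rewrite ?big_nil ?mulr1 ?size_poly_gt0//.
  by move=> x Ax; apply/negP => px; apply: noroot; exists x.
have q0 : q != 0 by apply: contra_neq p0 => q0; rewrite pE q0 mul0r.
have spq : size p = (size q).+1.
  by rewrite pE size_Mmonic ?monicXsubC// size_XsubC addn2.
have [|rs [q1 [qE srs Ars q1A]]] := IH q _ q0; first by rewrite -spq.
exists (x :: rs), q1; split=> // [||r]; rewrite ?spq//.
  by rewrite big_cons pE qE mulrAC mulrA.
by rewrite inE => /predU1P[->|/Ars].
Qed.

Lemma sgr_prod_subr (R : realDomainType) (s : R) (l : seq R) : s \notin l ->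
  Num.sg (\prod_(r <- l) (s - r)) = (-1) ^+ count (fun r => s < r) l.
Proof.
elim: l => [|r l IH]; first by rewrite big_nil sgr1.
rewrite inE negb_or big_cons sgrM => /andP[sr /IH ->] /=; rewrite exprD; congr (_ * _).
by case: (ltgtP s r) sr => // sr _;
  [rewrite ltr0_sg ?subr_lt0|rewrite gtr0_sg ?subr_gt0].
Qed.

Section WeylChamber.
Variables (R : realType) (n : nat) (t : R) (sg : 'I_n -> R).
Hypotheses (t0 : 0 <= t) (wsg : weyl t sg).

Lemma sigext_ord (k : 'I_n) : sigext t sg k.+1 = sg k.
Proof. by rewrite /sigext /= valK. Qed.

Lemma sigext_geq i : (n < i)%N -> sigext t sg i = t.
Proof. by case: i => // i ni; rewrite /sigext insubN// -leqNgt. Qed.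

Lemma sigext_itv i : 0 <= sigext t sg i <= t.
Proof.
case: i => [|i] /=; first by rewrite lexx t0.
by case: insub => [k|]; [exact: wsg.1|rewrite lexx t0].
Qed.

Lemma sigext_homo i j : (i <= j)%N -> sigext t sg i <= sigext t sg j.
Proof.
case: i j => [|i] [|j] // ij; first by have /andP[] := sigext_itv j.+1.
have [nj|jn] := leqP n j.
  by rewrite (@sigext_geq j.+1 nj); have /andP[] := sigext_itv i.+1.
have ni : (i < n)%N := leq_ltn_trans (ij : (i <= j)%N) jn.
by rewrite (sigext_ord (Ordinal ni)) (sigext_ord (Ordinal jn)); exact: wsg.2.
Qed.

End WeylChamber.

Section SortedSwitchingTimes.
Variables (R : realType) (n : nat) (t : R) (l : seq R).
Hypotheses (t0 : 0 <= t) (size_l : size l = n) (sorted_l : sorted <=%R l).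
Hypothesis l_itv : {in l, forall r, 0 <= r <= t}.

Let sg (k : 'I_n) : R := l`_k.

Lemma sorted_weyl : weyl t sg.
Proof.
split=> [i|i j ij]; first by apply: l_itv; rewrite mem_nth ?size_l.
by apply: (le_sorted_leq_nth 0 sorted_l); rewrite ?inE ?size_l.
Qed.

Lemma sorted_sigext_count (s : R) (i : nat) : (i <= n)%N ->
  sigext t sg i < s < sigext t sg i.+1 ->
  s \notin l /\ (count (fun r => s < r)%R l + i = n)%N.
Proof.
move=> i_n /andP[si iS]; have sg_homo := sigext_homo t0 sorted_weyl.
have nthE j : (j < n)%N -> l`_j = sigext t sg j.+1.
  by move=> jn; rewrite (sigext_ord t sg (Ordinal jn)).
have lt_s j : (j < i)%N -> l`_j < s.
  by move=> ji; rewrite nthE ?(leq_trans ji)//; apply: le_lt_trans si; exact: sg_homo.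
have gt_s j : (i <= j)%N -> (j < n)%N -> s < l`_j.
  by move=> ij jn; rewrite nthE//; apply: lt_le_trans iS _; exact: sg_homo.
split.
  apply/negP => /(nthP 0)[j]; rewrite size_l => jn js.
  by have [/lt_s|/gt_s/(_ jn)] := ltnP j i; rewrite js ltxx.
rewrite -(cat_take_drop i l) count_cat (eq_in_count (a2 := pred0)) => [|r].
  rewrite count_pred0 add0n (eq_in_count (a2 := predT)) => [|r].
    by rewrite count_predT size_drop size_l subnK.
  move=> /(nthP 0)[j]; rewrite size_drop size_l ltn_subRL nth_drop => ijn <-.
  by rewrite gt_s// leq_addr.
move=> /(nthP 0)[j]; rewrite size_takel ?size_l// => ji <-.
by rewrite nth_take//= ltNge ltW ?lt_s.
Qed.

End SortedSwitchingTimes.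

Lemma poly_sgr_switching (R : realType) (t : R) (n : nat) (p : {poly R}) :
  0 <= t -> p != 0 -> (size p <= n.+1)%N ->
  exists (sg : 'I_n -> R) (e : R), [/\ weyl t sg, e = 1 \/ e = -1 &
    forall i s, (i <= n)%N -> sigext t sg i < s < sigext t sg i.+1 ->
      Num.sg p.[s] = e * (-1) ^+ i].
Proof.
move=> t0 p0 sp; have [rs [q [pE srs rst q0]]] := poly_factor_roots_in `[0, t] p0.
have srsn : (size rs <= n)%N by rewrite -ltnS (leq_trans srs).
(* Padding with [t] keeps the sign pattern on [`[0, t[]. *)
pose l := sort <=%R (rs ++ nseq (n - size rs) t).
have size_l : size l = n by rewrite size_sort size_cat size_nseq subnKC.
have sorted_l : sorted <=%R l by exact/sort_sorted/le_total.
have l_itv : {in l, forall r, 0 <= r <= t}.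
  move=> r; rewrite mem_sort mem_cat => /orP[/rst|]; first by rewrite /= in_itv.
  by rewrite mem_nseq => /andP[_ /eqP->]; rewrite t0 lexx.
have wsg := sorted_weyl size_l sorted_l l_itv.
exists (fun k => l`_k), (Num.sg q.[0] * (-1) ^+ size rs); split=> //.
  have q00 : q.[0] != 0 by rewrite -rootE q0//= in_itv/= lexx.
  by apply/pred2P; rewrite -sqrf_eq1 exprMn sqrr_sign sqr_sg q00 mulr1.
move=> i s i_n si; have [sNl] := sorted_sigext_count t0 size_l sorted_l l_itv i_n si.
have [s0 st] : 0 <= s /\ s < t.
  move/andP: si => [/ltW si iS]; split.
    by apply: le_trans si; have /andP[] := sigext_itv t0 wsg i.
  by apply: lt_le_trans iS _; have /andP[] := sigext_itv t0 wsg i.+1.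
have sNrs : s \notin rs by apply: contra sNl => srs'; rewrite mem_sort mem_cat srs'.
rewrite (permP (permEl (perm_sort _ _))) count_cat count_nseq st mul1n addnAC.
rewrite -[RHS](subnKC srsn) => /addIn count_rs.
rewrite pE hornerM horner_prod sgrM; under eq_bigr do rewrite hornerXsubC.
rewrite sgr_prod_subr// -count_rs exprD -2!mulrA -expr2 sqrr_sign mulr1; congr (_ * _).
apply: (@polyrN0_itv _ `[0, t]); rewrite ?in_itv/= ?s0 ?(ltW st) ?lexx//.
Qed.

Lemma poly_ae_neq0 (R : realType) (p : {poly R}) : p != 0 ->
  {ae (@lebesgue_measure R), forall s, p.[s] != 0}.
Proof.
move=> p0; have [rs [q [pE _ _ q0]]] := poly_factor_roots_in setT p0.
exists [set` rs]; split.
- exact/countable_measurable/finite_set_countable/finite_seq.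
- exact/countable_lebesgue_measure0/finite_set_countable/finite_seq.
by move=> s /negP; rewrite negbK -rootE pE rootM (negbTE (q0 s I)) root_prod_XsubC.
Qed.

(** * Integrals on a segment *)

Lemma le_bounded_on (T : Type) (R : realFieldType) (A : set T) (f : T -> R) (M : R) :
  (forall x, A x -> `|f x| <= M) -> [bounded f x | x in A].
Proof.
move=> fM; exists M; split=> [|N MN x /fM fx]; first exact: num_real.
exact: le_trans fx (ltW MN).
Qed.

Section RealIntegrable.
Context d (T : measurableType d) (R : realType) (mu : {measure set T -> \bar R}).
Variable D : set T.
Hypothesis mD : measurable D.
Implicit Types f g : T -> R.

Lemma integrable_EFinZl (c : R) f : mu.-integrable D (EFin \o f) ->
  mu.-integrable D (EFin \o (fun x => c * f x)).
Proof. exact: integrableZl. Qed.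

Lemma integrable_EFinD f g : mu.-integrable D (EFin \o f) ->
    mu.-integrable D (EFin \o g) ->
  mu.-integrable D (EFin \o (fun x => f x + g x)).
Proof. exact: integrableD. Qed.

Lemma integrable_EFinB f g : mu.-integrable D (EFin \o f) ->
    mu.-integrable D (EFin \o g) ->
  mu.-integrable D (EFin \o (fun x => f x - g x)).
Proof. exact: integrableB. Qed.

Lemma Rintegral_sum (I : Type) (r : seq I) (f : I -> T -> R) :
  (forall i, mu.-integrable D (EFin \o f i)) ->
  \int[mu]_(x in D) (\sum_(i <- r) f i x) = \sum_(i <- r) \int[mu]_(x in D) f i x.
Proof.
move=> intf; elim: r => [|i r IH].
  by under eq_Rintegral do rewrite big_nil; rewrite big_nil Rintegral_cst// mul0r.
under eq_Rintegral do rewrite big_cons; rewrite big_cons RintegralD ?IH//.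
rewrite (_ : _ \o _ = fun x => \sum_(j <- r) (EFin \o f j) x)%E.
  exact: integrable_sum.
by apply/funext => x /=; rewrite sumEFin.
Qed.

End RealIntegrable.

Section SegmentIntegral.
Variable R : realType.
Implicit Types (a b c : R) (f g F : R -> R).
Local Notation mu := (@lebesgue_measure R).

Lemma lebesgue_measure_segment_lty a b : (mu `[a, b] < +oo)%E.
Proof. by rewrite lebesgue_measure_itv; case: ifP => _; rewrite ltry. Qed.

Lemma within_continuousM (A : set R) f g : {within A, continuous f} ->
  {within A, continuous g} -> {within A, continuous (fun s => f s * g s)}.
Proof. by move=> cf cg x; apply: cvgM; [exact: cf|exact: cg]. Qed.

Lemma within_continuous_bounded a b f : {within `[a, b], continuous f} ->
  exists2 K : R, 0 <= K & forall s, a <= s <= b -> `|f s| <= K.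
Proof.
move=> /continuous_compact/(_ (@segment_compact _ _ _))/compact_bounded[M [_ fM]].
exists (`|M| + 1) => [|s sab]; first by rewrite addr_ge0.
by apply: (fM (`|M| + 1)); [rewrite ltr_pwDr// ler_norm|exists s; rewrite //= in_itv].
Qed.

Lemma within_continuous_integrable a b f :
  {within `[a, b], continuous f} -> mu.-integrable `[a, b] (EFin \o f).
Proof.
by move=> cf; apply: continuous_compact_integrable => //; exact: segment_compact.
Qed.

Lemma integrableM_continuous a b f g : mu.-integrable `[a, b] (EFin \o f) ->
  {within `[a, b], continuous g} ->
    mu.-integrable `[a, b] (EFin \o (fun s => f s * g s)).
Proof.
move=> intf cg; have [K _ gK] := within_continuous_bounded cg.
rewrite (_ : _ \o _ = (EFin \o f) \* (EFin \o g))%E//.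
apply: integrableMl => //; first exact: subspace_continuous_measurable_fun.
by apply: (@le_bounded_on _ _ _ _ K) => s; rewrite /= in_itv; exact: gK.
Qed.

Lemma Rintegral_itv_cat a b c f : a <= b -> b <= c ->
    mu.-integrable `[a, c] (EFin \o f) ->
  \int[mu]_(x in `[a, c]) f x =
    \int[mu]_(x in `[a, b]) f x + \int[mu]_(x in `[b, c]) f x.
Proof.
move=> ab bc intf; apply/eqP; rewrite addrC -subr_eq Rintegral_itvB ?bnd_simp//.
rewrite Rintegral_itv_obnd_cbnd//; apply: integrableS intf => //.
by apply: subset_itv; rewrite bnd_simp.
Qed.

Lemma Rintegral_partition f (tau : nat -> R) (k : nat) :
  {homo tau : i j / (i <= j)%N >-> i <= j} ->
  mu.-integrable `[tau 0, tau k] (EFin \o f) ->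
  \sum_(i < k) \int[mu]_(x in `[tau i, tau i.+1]) f x =
    \int[mu]_(x in `[tau 0, tau k]) f x.
Proof.
move=> tau_homo; elim: k => [|k IH] intf.
  by rewrite big_ord0 set_itv1 Rintegral_set1.
rewrite big_ord_recr /= IH.
  by rewrite -Rintegral_itv_cat// tau_homo.
by apply: integrableS intf => //; apply: subset_itvl; rewrite bnd_simp tau_homo.
Qed.

Lemma eq_Rintegral_oo a b f g : mu.-integrable `[a, b] (EFin \o f) ->
  mu.-integrable `[a, b] (EFin \o g) -> {in `]a, b[, f =1 g} ->
  \int[mu]_(x in `[a, b]) f x = \int[mu]_(x in `[a, b]) g x.
Proof.
have ooE h : mu.-integrable `[a, b] (EFin \o h) ->
    \int[mu]_(x in `[a, b]) h x = \int[mu]_(x in `]a, b[) h x.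
  move=> inth; rewrite -Rintegral_itv_bndo_bndc -?Rintegral_itv_obnd_cbnd//.
    by apply: integrableS inth => //; exact: subset_itv_oo_cc.
  by apply: integrableS inth => //; exact: subset_itv_co_cc.
by move=> /ooE-> /ooE-> fg; apply: eq_Rintegral => x /[!inE] /fg.
Qed.

Lemma Rintegral_is_derive a b f F : a <= b -> {within `[a, b], continuous f} ->
  {within `[a, b], continuous F} ->
    (forall s, a < s < b -> is_derive s (1 : R) F (f s)) ->
  \int[mu]_(x in `[a, b]) f x = F b - F a.
Proof.
rewrite le_eqVlt => /predU1P[->|ab] cf cF dF.
  by rewrite set_itv1 Rintegral_set1 subrr.
rewrite /Rintegral (@continuous_FTC2 R f F)//.
- have [_ Fa Fb] := (continuous_within_itvP _ ab).1 cF.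
  by split => // x; rewrite in_itv /= => /dF[].
- by move=> x; rewrite in_itv /= => /dF dFx; rewrite derive1E derive_val.
Qed.

Lemma exists_primitive a b f c : a < b -> {within `[a, b], continuous f} ->
  exists F, [/\ {within `[a, b], continuous F}, F a = c &
    forall s, a < s < b -> is_derive s (1 : R) F (f s)].
Proof.
move=> ab cf; have intf := within_continuous_integrable cf.
exists (cst c + fun x => \int[mu]_(y in `[a, x]) f y); split.
- apply: within_continuousD; first by move=> x; exact: cvg_cst.
  exact: (parameterized_integral_continuous (ltW ab) intf).
- by rewrite fctE set_itv1 Rintegral_set1 addr0.
move=> s /andP[as_ sb]; rewrite -[f s]add0r; apply: is_deriveD.
have [cfs _ _] := (continuous_within_itvP _ ab).1 cf.
have [|dF F's] := continuous_FTC1_closed sb intf as_.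
  by apply: cfs; rewrite in_itv/= as_.
by apply: DeriveDef => //; rewrite -derive1E.
Qed.

Lemma Rintegral_reflect a b f : a <= b -> {within `[a, b], continuous f} ->
  \int[mu]_(x in `[a, b]) f (a + b - x) = \int[mu]_(x in `[a, b]) f x.
Proof.
move=> ab cf; pose F x : R := a + b - x.
have dF x : is_derive x (1 : R) F (-1).
  by rewrite (_ : F = cst (a + b) - id)//; apply: is_derive_eq; rewrite sub0r.
have F' : derive1 F = cst (-1) by apply/funext => x; rewrite derive1E derive_val.
have cF : continuous F by move=> x; exact/differentiable_continuous/derivable1_diffP.
have Fa : F a = b by rewrite /F; ring.
have Fb : F b = a by rewrite /F addrK.
have := @integration_by_substitution_decreasing _ F f a b ab.
rewrite Fa Fb /Rintegral => ->//.
- by congr fine; apply: eq_integral => x _; rewrite F' !fctE opprK mulr1.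
- by move=> x y _ _ xy; rewrite /F ltrD2l ltrN2.
- by rewrite F' => x _; exact: cvg_cst.
- by rewrite F'; exact: is_cvg_cst.
- by rewrite F'; exact: is_cvg_cst.
- by split=> [x _||]; [|exact/cvg_at_right_filter/cF|exact/cvg_at_left_filter/cF].
Qed.

End SegmentIntegral.

(** * Integrals against a weight that vanishes almost nowhere *)

Lemma continuous_invr_normD (R : realType) (e : R) : 0 < e ->
  continuous (fun x : R => (`|x| + e)^-1).
Proof.
move=> e0 x; apply: cvgV; first by rewrite gt_eqF// ltr_wpDl.
by apply: cvgD; [exact: norm_continuous|exact: cvg_cst].
Qed.

Lemma continuous_resolvent (R : realType) (e : R) : 0 < e ->
  continuous (fun x : R => e / (`|x| + e)).
Proof.
by move=> e0 x; apply: cvgM; [exact: cvg_cst|exact: continuous_invr_normD].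
Qed.

Lemma continuous_smoothed_sgr (R : realType) (e : R) : 0 < e ->
  continuous (fun x : R => x / (`|x| + e)).
Proof.
by move=> e0 x; apply: cvgM; [exact: cvg_id|exact: continuous_invr_normD].
Qed.

Lemma resolvent_itv (R : realFieldType) (e x : R) : 0 < e -> 0 <= e / (`|x| + e) <= 1.
Proof.
move=> e0; have xe : 0 < `|x| + e by rewrite ltr_wpDl.
by rewrite divr_ge0 ?(ltW e0) ?(ltW xe)// ler_pdivrMr// mul1r lerDr normr_ge0.
Qed.

Section AlmostNonzeroWeight.
Context d (T : measurableType d) (R : realType) (mu : {measure set T -> \bar R}).
Variables (D : set T) (p : T -> R).
Hypotheses (mD : measurable D) (finD : (mu D < +oo)%E) (mp : measurable_fun D p).
Hypothesis p0 : {ae mu, forall s, D s -> p s != 0}.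

Lemma integrable_resolvent (e : R) : 0 < e ->
  mu.-integrable D (EFin \o (fun s => e / (`|p s| + e))).
Proof.
move=> e0; apply: measurable_bounded_integrable => //.
  exact: measurableT_comp (continuous_measurable_fun (continuous_resolvent e0)) mp.
apply: (@le_bounded_on _ _ _ _ 1) => s _ /=.
by have /andP[r0 r1] := resolvent_itv (p s) e0; rewrite ger0_norm.
Qed.

Lemma Rintegral_resolvent_small (e : R) : 0 < e ->
  exists2 c : R, 0 < c & \int[mu]_(s in D) (c / (`|p s| + c)) <= e.
Proof.
move=> e0; pose c (k : nat) : R := harmonic k.
have c0 k : 0 < c k by rewrite /c /= invr_gt0.
pose f k s := c k / (`|p s| + c k).
have f_cvg : {ae mu, forall s, D s -> (EFin \o f k) s @[k --> \oo] --> 0%E}.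
  apply: filterS p0 => s ps Ds; have {}ps := ps Ds.
  apply: cvg_EFin; first exact: nearW.
  have -> : (0 : R) = 0 / (`|p s| + 0) by rewrite mul0r.
  apply: cvgM; first exact: cvg_harmonic.
  apply: cvgV; first by rewrite addr0 normr_eq0.
  by apply: cvgD; [exact: cvg_cst|exact: cvg_harmonic].
have f_le1 : {ae mu, forall s k, D s -> (`|(EFin \o f k) s| <= 1%:E)%E}.
  apply: aeW => s k _ /=; have /andP[r0 r1] := resolvent_itv (p s) (c0 k).
  by rewrite lee_fin ger0_norm.
have [] := dominated_convergence mD _ (measurable_cst 0%E) f_cvg _ f_le1.
- by move=> k; apply: measurable_int (integrable_resolvent (c0 k)).
- apply: measurable_bounded_integrable => //.
  by apply: (@le_bounded_on _ _ _ _ 1) => s _ /=; rewrite normr1.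
move=> _ _; rewrite integral0 => /fine_cvgP[_ /cvgrPdist_le /(_ e e0)].
move=> [N _ /(_ N (leqnn N))] /=; rewrite sub0r normrN => fe.
by exists (c N) => //; apply: le_trans fe; exact: ler_norm.
Qed.

(* Pointwise [h <= c^-1 * (h * |p|) + M * (c / (|p| + c))]. *)
Lemma Rintegral_weighted_small (M e : R) : 0 <= M -> 0 < e ->
  mu.-integrable D (EFin \o p) ->
  exists2 del : R, 0 < del & forall h : T -> R, measurable_fun D h ->
    (forall s, D s -> 0 <= h s <= M) ->
    \int[mu]_(s in D) (h s * `|p s|) <= del -> \int[mu]_(s in D) h s <= e.
Proof.
move=> M0 e0 intp; have M1 : 0 < M + 1 by rewrite ltr_wpDl.
have [|c c0 ce] := @Rintegral_resolvent_small (e / 2 / (M + 1)).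
  by rewrite !divr_gt0.
exists (e / 2 * c) => [|h mh hM hp]; first by rewrite mulr_gt0 ?divr_gt0.
have bh : [bounded h s | s in D].
  by apply: (@le_bounded_on _ _ _ _ M) => s /hM/andP[h0 hs] /=; rewrite ger0_norm.
have inth : mu.-integrable D (EFin \o h) by exact: measurable_bounded_integrable.
have inthp : mu.-integrable D (EFin \o (fun s => h s * `|p s|)).
  rewrite (_ : _ \o _ = (EFin \o h) \* (EFin \o (fun s => `|p s|%R)))%E//.
  by apply: integrableMr => //; exact: integrable_norm.
have h_le s : D s -> h s <= c^-1 * (h s * `|p s|) + M * (c / (`|p s| + c)).
  move=> /hM/andP[h0 hs]; have pc : 0 < `|p s| + c by rewrite ltr_wpDl.
  apply: (@le_trans _ _ (h s * `|p s| / (`|p s| + c) + h s * (c / (`|p s| + c)))).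
    by rewrite mulrA -mulrDl -mulrDr mulfK ?gt_eqF.
  apply: lerD; last by rewrite ler_wpM2r// divr_ge0 ?ltW.
  by rewrite mulrC ler_wpM2r ?mulr_ge0// lef_pV2 ?posrE// lerDr.
apply: (@le_trans _ _ (c^-1 * (e / 2 * c) + M * (e / 2 / (M + 1)))); last first.
  rewrite mulrCA mulVf ?gt_eqF// mulr1 [leRHS]splitr lerD2l mulrCA.
  by rewrite ler_piMr ?divr_ge0 ?(ltW e0)// ler_pdivrMr// mul1r lerDl.
have intr := integrable_resolvent c0.
have intl := integrable_EFinZl mD c^-1 inthp; have intR := integrable_EFinZl mD M intr.
apply: (le_trans (le_Rintegral mD inth (integrable_EFinD mD intl intR) h_le)).
rewrite RintegralD// (RintegralZl _ mD inthp) (RintegralZl _ mD intr).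
by rewrite lerD// ler_wpM2l// invr_ge0 ltW.
Qed.

End AlmostNonzeroWeight.

Definition strongly_exposes (R : realType) (V : normedModType R) (phi : V -> R)
    (C : set V) (x : V) :=
  forall e, 0 < e -> exists2 del, 0 < del &
    forall y, C y -> phi x - phi y <= del -> `|x - y| <= e.

Lemma strongly_exposes_unique (R : realType) (V : normedModType R) (phi : V -> R)
    (C : set V) (x z : V) : strongly_exposes phi C x -> {for z, continuous phi} ->
  closure C z -> phi x <= phi z -> z = x.
Proof.
move=> xC phiz Cz xz; apply/eqP; rewrite -subr_eq0 -normr_le0.
apply/ler_addgt0Pr => e e0.
have [|del del0 delC] := xC (e / 2); first by rewrite divr_gt0.
have [y [Cy [/= zy phizy]]] :
    C `&` [set y | `|z - y| <= e / 2 /\ phi z - phi y <= del] !=set0.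
  apply: Cz; apply: filterI.
    by apply: cvgr_dist_le; [exact: cvg_id|rewrite divr_gt0].
  have : \forall y \near z, `|phi z - phi y| <= del by exact: cvgr_dist_le.
  by apply: filterS => y; apply: le_trans; exact: ler_norm.
rewrite add0r (splitr e) -(subrK y z) -addrA (le_trans (ler_normD _ _))// lerD//.
by rewrite distrC delC// (le_trans _ phizy)// lerD2r.
Qed.

(** * Endpoints of integrator trajectories *)

Lemma is_derive_mxP (R : realType) (m n : nat) (x : R -> 'M[R]_(m, n)) (s : R)
    (v : 'M[R]_(m, n)) :
  is_derive s (1 : R) x v <->
    forall i j, is_derive s (1 : R) (fun r => x r i j) (v i j).
Proof.
split=> [[dx xv] i j|dx].
  apply: DeriveDef; first exact: ((derivable_mxP x s 1).1 dx).
  by rewrite -xv derive_mx// mxE.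
have dxs : derivable x s 1 by apply/derivable_mxP => i j; have [] := dx i j.
apply: DeriveDef => //; rewrite derive_mx//; apply/matrixP => i j; rewrite mxE.
by have [] := dx i j.
Qed.

Lemma within_continuous_mxP (R : realType) (m n : nat) (A : set R)
    (x : R -> 'M[R]_(m, n)) :
  {within A, continuous x} <-> forall i j, {within A, continuous (fun r => x r i j)}.
Proof.
split=> [cx i j r|cx].
  by apply: (@continuous_comp (subspace A) _ _ x (fun M => M i j));
    [exact: cx|exact: coord_continuous].
apply/subspace_continuousP => r Ar; apply/cvg_ballP => e e0.
have : \forall r' \near within A (nbhs r), forall i j, ball (x r i j) e (x r' i j).
  apply: filter_forall => i; apply: filter_forall => j.
  by move/subspace_continuousP : (cx i j) => /(_ r Ar) /cvg_ballP; exact.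
by apply: filterS => r' xr'; split.
Qed.

Section TaylorRemainder.
Variable R : realType.
Implicit Types (a b r s : R) (m : nat) (y : nat -> R -> R).

Lemma is_derive_taylor_weight b s m :
  is_derive s (1 : R) (fun r => (b - r) ^+ m.+1 / (m.+1)`!%:R)
    (- ((b - s) ^+ m / m`!%:R)).
Proof.
rewrite (_ : (fun r => _) = ((m.+1)`!%:R^-1 : R) \*: ((cst b - id) ^+ m.+1 : R -> R)).
  apply: is_derive_eq; rewrite sub0r /GRing.scale /= factS natrM invfM !fctE.
  by field; rewrite addrC natr1 !pnatr_eq0 -lt0n fact_gt0.
by apply/funext => r /=; rewrite exprfctE mulrC.
Qed.

Lemma continuous_taylor_weight b m : continuous (fun r => (b - r) ^+ m / m`!%:R).
Proof.
move=> s; apply: cvgM; last exact: cvg_cst.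
apply: (@continuous_comp _ _ _ (fun r : R => b - r) (fun r => r ^+ m)).
  by apply: cvgB; [exact: cvg_cst|exact: cvg_id].
exact: exprn_continuous.
Qed.

Lemma taylor_integral_remainder a b m y : a <= b ->
  (forall j, (j <= m.+1)%N -> {within `[a, b], continuous (y j)}) ->
  (forall j s, (j <= m)%N -> a < s < b -> is_derive s (1 : R) (y j) (y j.+1 s)) ->
  y 0%N b = \sum_(j < m.+1) (b - a) ^+ j / j`!%:R * y j a +
    \int[@lebesgue_measure R]_(s in `[a, b]) (y m.+1 s * ((b - s) ^+ m / m`!%:R)).
Proof.
move=> ab; elim: m => [|m IH] cy dy.
  rewrite big_ord1 expr0 divr1 mul1r; under eq_Rintegral do rewrite mulr1.
  by rewrite (Rintegral_is_derive ab (cy 1 _) (cy 0 _) (fun s => dy 0 s _))// subrKC.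
have cw k : {within `[a, b], continuous (fun r => (b - r) ^+ k / k`!%:R)}.
  exact/continuous_subspaceT/continuous_taylor_weight.
have c1 := within_continuousM (cy m.+2 (leqnn _)) (cw m.+1).
have c2 := within_continuousM (cy m.+1 (leqnSn _)) (cw m).
have parts : \int[@lebesgue_measure R]_(s in `[a, b])
    (y m.+2 s * ((b - s) ^+ m.+1 / (m.+1)`!%:R) - y m.+1 s * ((b - s) ^+ m / m`!%:R)) =
    - (y m.+1 a * ((b - a) ^+ m.+1 / (m.+1)`!%:R)).
  pose F s := y m.+1 s * ((b - s) ^+ m.+1 / (m.+1)`!%:R).
  have -> : - (y m.+1 a * ((b - a) ^+ m.+1 / (m.+1)`!%:R)) = F b - F a.
    by rewrite /F subrr expr0n /= mul0r mulr0 sub0r.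
  apply: Rintegral_is_derive => //;
    [exact: within_continuousB|exact/within_continuousM/cw/cy|].
  move=> s abs; have dym := dy m.+1 s (leqnn _) abs.
  have dw := is_derive_taylor_weight b s m.
  by apply: is_derive_eq; rewrite /GRing.scale /=; ring.
apply: etrans (IH (fun j jm => cy j (leqW jm)) (fun j s jm => dy j s (leqW jm))) _.
rewrite [in RHS]big_ord_recr /= -addrA; congr (_ + _).
move: parts; rewrite RintegralB//; [|exact: within_continuous_integrable..].
lra.
Qed.

End TaylorRemainder.

Section Integrator.
Variables (R : realType) (n : nat).
Implicit Types (x : 'cV[R]_n.+1) (u t : R).

(* Along a trajectory every entry is the derivative of the preceding one, the input
   coming last. *)
Definition integrator_chain x u (i : nat) : R :=
  if insub i is Some k then x k 0 else u.

Lemma integrator_chain_ord x u (k : 'I_n.+1) : integrator_chain x u k = x k 0.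
Proof. by rewrite /integrator_chain valK. Qed.

Lemma integrator_chain_last x u : integrator_chain x u n.+1 = u.
Proof. by rewrite /integrator_chain insubN// ltnn. Qed.

Lemma integrator_chain_col (y : nat -> R) i : (i <= n.+1)%N ->
  integrator_chain (\col_k y k) (y n.+1) i = y i.
Proof.
rewrite leq_eqVlt => /predU1P[->|ltin]; first by rewrite integrator_chain_last.
by rewrite (integrator_chain_ord _ _ (Ordinal ltin)) mxE.
Qed.

Lemma Aint_bcon_chain x u (k : 'I_n.+1) :
  (Aint R n *m x + u *: bcon R n) k 0 = integrator_chain x u k.+1.
Proof.
rewrite !mxE; have [kn|nk] := ltnP k n.
  have kn1 : (k.+1 < n.+1)%N by [].
  rewrite (integrator_chain_ord x u (Ordinal kn1)) (bigD1 (Ordinal kn1))//=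
    mxE eqxx mul1r.
  rewrite big1 => [|j jk]; first by rewrite addr0 -val_eqE /= ltn_eqF// mulr0 addr0.
  by rewrite mxE; move: jk; rewrite -val_eqE /= => /negbTE ->; rewrite mul0r.
have -> : k = ord_max by apply/val_inj/anti_leq; rewrite /= nk -ltnS ltn_ord.
rewrite integrator_chain_last eqxx mulr1 big1 ?add0r// => j _.
by rewrite mxE ltn_eqF ?mul0r//=.
Qed.

Lemma chi_chain t x u (k : 'I_n.+1) :
  chi t x k 0 = \sum_(j < (n - k).+1) t ^+ j / j`!%:R * integrator_chain x u (j + k).
Proof.
rewrite mxE (eq_bigr (fun l : 'I_n.+1 =>
  t ^+ (l - k) / (l - k)`!%:R * integrator_chain x u l)) => [|l _]; last first.
  by rewrite integrator_chain_ord.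
rewrite -(big_geq_mkord k n.+1 xpredT
  (fun l => t ^+ (l - k) / (l - k)`!%:R * integrator_chain x u l)).
rewrite -[X in \sum_(X <= _ < _) _]add0n big_addn subSn ?leq_ord// big_mkord.
by apply: eq_bigr => j _; rewrite addnK.
Qed.

End Integrator.

Section IntegratorEndpoint.
Variables (R : realType) (n : nat) (t : R) (x0 : 'cV[R]_n.+1).
Hypothesis t0 : 0 < t.
Implicit Types (u : R -> R) (x : R -> 'cV[R]_n.+1).
Local Notation mu := (@lebesgue_measure R).

Definition endpoint u : 'cV[R]_n.+1 :=
  chi t x0 + Rintv 0 t (fun s => u s *: xi n (t - s)).

Lemma Rintv_xiE a b u (k : 'I_n.+1) :
  Rintv a b (fun s => u s *: xi n (t - s)) k 0 =
  \int[mu]_(s in `[a, b]) (u s * xi n (t - s) k 0).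
Proof. by rewrite mxE; apply: eq_Rintegral => s _; rewrite mxE. Qed.

Lemma endpointE u (k : 'I_n.+1) :
  endpoint u k 0 = chi t x0 k 0 + \int[mu]_(s in `[0, t]) (u s * xi n (t - s) k 0).
Proof. by rewrite mxE Rintv_xiE. Qed.

Lemma trajectory_endpoint u x : {within `[0, t], continuous u} ->
  {within `[0, t], continuous x} -> x 0 = x0 ->
  (forall s, 0 < s < t -> is_derive s (1 : R) x (Aint R n *m x s + u s *: bcon R n)) ->
  x t = endpoint u.
Proof.
move=> cu /within_continuous_mxP cx x00 dx; apply/colP => k.
pose y j s := integrator_chain (x s) (u s) (j + k).
have y_ord j (jkn : (j + k < n.+1)%N) : y j = fun s => x s (Ordinal jkn) 0.
  by apply/funext => s; rewrite /y (integrator_chain_ord _ _ (Ordinal jkn)).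
have y_last : y (n - k).+1 = u.
  by apply/funext => s; rewrite /y addSn subnK ?leq_ord// integrator_chain_last.
have jkn j : (j <= n - k)%N -> (j + k < n.+1)%N.
  by rewrite ltnS addnC -leq_subRL ?leq_ord.
have -> : x t k 0 = y 0%N t by rewrite /y integrator_chain_ord.
apply: etrans (@taylor_integral_remainder _ 0 t (n - k)%N y (ltW t0) _ _) _
  => [j|j s jn st|].
- by rewrite leq_eqVlt => /predU1P[->|/jkn jn]; rewrite ?y_last// (y_ord _ jn);
  exact: cx.
- have /is_derive_mxP/(_ (Ordinal (jkn j jn)) 0) := dx s st.
  by rewrite Aint_bcon_chain (y_ord _ (jkn j jn)).
rewrite endpointE (chi_chain _ _ (u 0)) subr0 -x00 y_last; congr (_ + _).
by apply: eq_Rintegral => s _; rewrite mxE.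
Qed.

Lemma exists_primitive_chain u (m : nat) (c : nat -> R) :
    {within `[0, t], continuous u} ->
  exists y : nat -> R -> R, [/\ y m = u,
    forall i, (i <= m)%N -> {within `[0, t], continuous (y i)},
    forall i, (i < m)%N -> y i 0 = c i &
    forall i s, (i < m)%N -> 0 < s < t -> is_derive s (1 : R) (y i) (y i.+1 s)].
Proof.
move=> cu; elim: m c => [|m IH] c; first by exists (fun=> u); split.
have [y [ym cy y0 dy]] := IH (fun i => c i.+1).
have [F [cF F0 dF]] := exists_primitive (c 0%N) t0 (cy 0%N isT).
exists (fun i => if i is j.+1 then y j else F); split=> //.
- by case.
- by case.
- by case=> [|i] s im st; [exact: dF|exact: dy].
Qed.

Definition controls (ulo uhi : R -> R) : set (R -> R) :=
  [set u | {within `[0, t], continuous u} /\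
    forall s, 0 <= s <= t -> ulo s <= u s <= uhi s].

Lemma reach_setE (ulo uhi : R -> R) :
  reach_set ulo uhi t x0 = endpoint @` controls ulo uhi.
Proof.
apply/seteqP; split=> [_ [u [x [cu bu [cx x00] dx ->]]]|_ [u [cu bu] <-]].
  by exists u => //; rewrite -(trajectory_endpoint cu cx x00 dx).
have [y [y_last cy y0 dy]] := exists_primitive_chain n.+1 (fun i => x0 (inord i) 0) cu.
pose x s : 'cV[R]_n.+1 := \col_i y i s.
have xE i : (fun s => x s i 0) = y i by apply/funext => s; rewrite mxE.
have cx : {within `[0, t], continuous x}.
  by apply/within_continuous_mxP => i j; rewrite ord1 xE; apply/cy/ltnW.
have x00 : x 0 = x0 by apply/colP => i; rewrite mxE y0// inord_val.
have dx s : 0 < s < t -> is_derive s (1 : R) x (Aint R n *m x s + u s *: bcon R n).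
  move=> st; apply/is_derive_mxP => i j.
  by rewrite ord1 Aint_bcon_chain xE -y_last (integrator_chain_col (fun i => y i s))//;
    exact: dy.
by exists u, x; split=> //; rewrite (trajectory_endpoint cu cx x00 dx).
Qed.

Lemma continuous_xi (k : 'I_n.+1) : continuous (fun s => xi n (t - s) k 0).
Proof.
rewrite (_ : (fun s => _) = fun s : R => (t - s) ^+ (n - k) / (n - k)`!%:R).
  exact: continuous_taylor_weight.
by apply/funext => s; rewrite mxE.
Qed.

Lemma integrableM_xi u (k : 'I_n.+1) : mu.-integrable `[0, t] (EFin \o u) ->
  mu.-integrable `[0, t] (EFin \o (fun s => u s * xi n (t - s) k 0)).
Proof.
by move=> /integrableM_continuous; apply; exact/continuous_subspaceT/continuous_xi.
Qed.

Lemma dotv_endpoint (eta : 'cV[R]_n.+1) u : mu.-integrable `[0, t] (EFin \o u) ->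
  dotv eta (endpoint u) =
  dotv eta (chi t x0) + \int[mu]_(s in `[0, t]) (u s * dotv eta (xi n (t - s))).
Proof.
move=> intu; rewrite linearD /=; congr (_ + _); rewrite dotvE.
under [RHS]eq_Rintegral do rewrite dotvE mulr_sumr.
have intz k :
    mu.-integrable `[0, t] (EFin \o (fun s => u s * (eta k 0 * xi n (t - s) k 0))).
  apply: integrableM_continuous => //; apply/continuous_subspaceT => s.
  by apply: cvgM; [exact: cvg_cst|exact: continuous_xi].
rewrite Rintegral_sum//; apply: eq_bigr => k _;
  rewrite Rintv_xiE -RintegralZl ?integrableM_xi//.
by apply: eq_Rintegral => s _; rewrite mulrCA.
Qed.

Lemma endpoint_conv (a b : R) u v : a + b = 1 -> mu.-integrable `[0, t] (EFin \o u) ->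
  mu.-integrable `[0, t] (EFin \o v) ->
  endpoint (fun s => a * u s + b * v s) = a *: endpoint u + b *: endpoint v.
Proof.
move=> ab intu intv; apply/colP => k.
rewrite [RHS]mxE [X in _ = X + _]mxE [X in _ = _ + X]mxE !endpointE.
have intuk := integrableM_xi k intu; have intvk := integrableM_xi k intv.
rewrite !mulrDr addrACA -mulrDl ab mul1r; congr (_ + _).
rewrite -!RintegralZl// -RintegralD//; [|exact: integrable_EFinZl..].
by apply: eq_Rintegral => s _; ring.
Qed.

Lemma convex_reach_set ulo uhi : convex_set (reach_set ulo uhi t x0).
Proof.
rewrite reach_setE; apply/convex_setP => _ _ a b [u [cu bu] <-] [v [cv bv] <-] a0 b0 ab.
exists (fun s => a * u s + b * v s).
  split=> [|s st].
    by apply: within_continuousD; apply: within_continuousM => // s; exact: cvg_cst.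
  have /andP[lu uu] := bu s st; have /andP[lv uv] := bv s st.
  rewrite -[ulo s]mul1r -[uhi s]mul1r -ab !mulrDl.
  by rewrite !lerD ?ler_wpM2l.
by rewrite endpoint_conv//; exact: within_continuous_integrable.
Qed.

Lemma xi_ge0 (s : R) (k : 'I_n.+1) : 0 <= s -> 0 <= xi n s k 0.
Proof. by move=> s0; rewrite mxE divr_ge0 ?exprn_ge0. Qed.

Lemma norm_xi_le_sum (s : R) (k : 'I_n.+1) : 0 <= s <= t ->
  `|xi n (t - s) k 0| <= \sum_j xi n t j 0.
Proof.
move=> /andP[s0 st]; rewrite ger0_norm ?xi_ge0 ?subr_ge0// (bigD1 k)//=.
rewrite ler_wpDr ?sumr_ge0// => [j _|]; first by rewrite xi_ge0 ?ltW.
by rewrite !mxE ler_wpM2r ?invr_ge0// lerXn2r ?nnegrE ?subr_ge0 ?gerBl ?(ltW t0).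
Qed.

Lemma norm_endpointB_le u v : mu.-integrable `[0, t] (EFin \o u) ->
  mu.-integrable `[0, t] (EFin \o v) ->
  `|endpoint u - endpoint v| <=
    (\sum_k xi n t k 0) * \int[mu]_(s in `[0, t]) `|u s - v s|.
Proof.
move=> intu intv.
have intd : mu.-integrable `[0, t] (EFin \o (fun s => u s - v s)).
  exact: integrable_EFinB.
rewrite [leLHS]/Num.norm /= mx_normrE; apply/bigmax_leP; split=> [|[k j] _] /=.
  by rewrite mulr_ge0 ?sumr_ge0 ?Rintegral_ge0// => k _; rewrite xi_ge0 ?ltW.
rewrite ord1 mxE [X in _ + X]mxE !endpointE opprD addrACA subrr add0r -RintegralB
  ?integrableM_xi//.
have -> : \int[mu]_(s in `[0, t]) (u s * xi n (t - s) k 0 - v s * xi n (t - s) k 0) =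
    \int[mu]_(s in `[0, t]) ((u s - v s) * xi n (t - s) k 0).
  by apply: eq_Rintegral => s _; rewrite mulrBl.
apply: le_trans (le_normr_Rintegral _ (integrableM_xi k intd)) _ => //.
rewrite -RintegralZl//; last exact: integrable_norm intd.
apply: le_Rintegral => // [||s].
- exact: integrable_norm (integrableM_xi k intd).
- exact/integrable_EFinZl/integrable_norm.
- by rewrite /= in_itv/= => st; rewrite normrM mulrC ler_wpM2r ?norm_xi_le_sum.
Qed.

End IntegratorEndpoint.

(** * The bang-bang principle *)

Lemma measurable_sgr (R : realType) : measurable_fun [set: R] (@Num.sg R).
Proof.
rewrite (_ : Num.sg = fun x : R => if 0 < x then 1 else if x < 0 then -1 else 0).
  by apply: measurable_fun_ifT => //; [exact: measurable_fun_ltr|];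
    apply: measurable_fun_ifT => //; exact: measurable_fun_ltr.
by apply/funext => x; case: sgrP.
Qed.

Lemma continuous_sum (T : topologicalType) (R : realType) (I : finType)
    (f : I -> T -> R) :
  (forall i, continuous (f i)) -> continuous (fun s => \sum_i f i s).
Proof.
by move=> cf; apply: continuous_big => [|i _]; [exact: add_continuous|exact: cf].
Qed.

Lemma continuous_dotv (T : topologicalType) (R : realType) (m : nat) (eta : 'cV[R]_m)
    (f : T -> 'cV[R]_m) :
  (forall k, continuous (fun s => f s k 0)) -> continuous (fun s => dotv eta (f s)).
Proof.
move=> cf; rewrite (_ : (fun s => _) = fun s => \sum_k eta k 0 * f s k 0); last first.
  by apply/funext => s; rewrite dotvE.
by apply: continuous_sum => k s; apply: cvgM; [exact: cvg_cst|exact: cf].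
Qed.

Lemma switching_poly (R : realType) (n : nat) (t : R) (eta : 'cV[R]_n.+1) : eta != 0 ->
  exists p : {poly R}, [/\ p != 0, (size p <= n.+1)%N &
    forall s, p.[s] = dotv eta (xi n (t - s))].
Proof.
move=> eta0; pose q := \poly_(k < n.+1) (eta (inord (n - k)) 0 / k`!%:R).
have sq : size (t%:P - 'X : {poly R}) = 2%N by rewrite -opprB size_polyN size_XsubC.
exists (q \Po (t%:P - 'X)); split=> [||s].
- rewrite -size_poly_gt0 size_comp_poly2// size_poly_gt0; apply: contra eta0 => /eqP q0.
  apply/eqP/colP => k; apply/eqP; move/polyP/(_ (n - k)%N) : q0.
  rewrite coef_poly coef0 ltnS leq_subr subKn ?leq_ord// inord_val mxE => /eqP.
  by rewrite mulf_eq0 invr_eq0 pnatr_eq0 eqn0Ngt fact_gt0 orbF.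
- by rewrite size_comp_poly2// size_poly.
rewrite horner_comp !hornerE horner_poly dotvE (reindex_inj rev_ord_inj) /=.
by apply: eq_bigr => k _; rewrite mxE subSS subKn ?leq_ord// inord_val mulrAC mulrA.
Qed.

Lemma switching_ae_neq0 (R : realType) (n : nat) (t : R) (eta : 'cV[R]_n.+1)
    (D : set R) :
  eta != 0 -> {ae (@lebesgue_measure R), forall s, D s -> dotv eta (xi n (t - s)) != 0}.
Proof.
move=> /(switching_poly t)[p [/poly_ae_neq0 + _ pE]].
apply: filterS; first exact: (ae_filter_ringOfSetsType (@lebesgue_measure R)).
by move=> s + _; rewrite pE.
Qed.

Section Modulated.
Variable R : realFieldType.
Implicit Types lo hi sgn u q e : R.

Definition modulated lo hi sgn := (hi + lo) / 2 + sgn * ((hi - lo) / 2).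

Lemma modulated_itv lo hi sgn : lo <= hi -> `|sgn| <= 1 ->
    lo <= modulated lo hi sgn <= hi.
Proof.
rewrite ler_norml /modulated => lohi /andP[sgn1 sgn2].
by apply/andP; split; nra.
Qed.

Lemma norm_modulatedB_le lo hi sgn u : lo <= u <= hi -> `|sgn| <= 1 ->
  `|modulated lo hi sgn - u| <= hi - lo.
Proof.
move=> /andP[lu uh] sgn1; have /andP[lm mh] := modulated_itv (le_trans lu uh) sgn1.
by rewrite ler_norml; apply/andP; split; lra.
Qed.

Lemma modulated_sgrB_weight lo hi u q : lo <= u <= hi ->
  (modulated lo hi (Num.sg q) - u) * q = `|modulated lo hi (Num.sg q) - u| * `|q|.
Proof.
rewrite /modulated => /andP[lu uh]; case: sgrP => [->|q0|q0].
- by rewrite !mulr0.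
- by rewrite ger0_norm//; lra.
- by rewrite ler0_norm ?mulrNN//; lra.
Qed.

Lemma norm_sgr_le1 q : `|Num.sg q| <= 1.
Proof. by rewrite normr_sg lern1 leq_b1. Qed.

Lemma norm_smoothed_sgr_le1 e q : 0 < e -> `|q / (`|q| + e)| <= 1.
Proof.
move=> e0; have qe : 0 < `|q| + e by rewrite ltr_wpDl.
by rewrite normrM normfV (gtr0_norm qe) ler_pdivrMr// mul1r lerDl ltW.
Qed.

Lemma modulated_smoothed_sgr_le lo hi q e : lo <= hi -> 0 < e ->
  (modulated lo hi (Num.sg q) - modulated lo hi (q / (`|q| + e))) * q <=
    e * ((hi - lo) / 2).
Proof.
move=> lohi e0; have qe : 0 < `|q| + e by rewrite ltr_wpDl.
rewrite (_ : _ * q = `|q| * (e / (`|q| + e)) * ((hi - lo) / 2)).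
  rewrite ler_wpM2r ?divr_ge0 ?subr_ge0// mulrCA ler_piMr ?(ltW e0)//.
  by rewrite ler_pdivrMr// mul1r lerDl ltW.
rewrite /modulated opprD addrACA subrr add0r -mulrBl mulrAC; congr (_ * _).
rewrite mulrBl -normrEsg mulrAC -expr2 -real_normK ?num_real//.
by field; rewrite gt_eqF.
Qed.

End Modulated.

Section BangBang.
Variables (R : realType) (n : nat) (t : R) (x0 eta : 'cV[R]_n.+1) (ulo uhi : R -> R).
Local Notation mu := (@lebesgue_measure R).
Local Notation X := (reach_set ulo uhi t x0).
Hypothesis t0 : 0 < t.
Hypothesis culo : {within `[0, t], continuous ulo}.
Hypothesis cuhi : {within `[0, t], continuous uhi}.

Let p s := dotv eta (xi n (t - s)).

Definition bang_bang s := modulated (ulo s) (uhi s) (Num.sg (p s)).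

Let continuous_p : continuous p.
Proof. by apply: continuous_dotv => k; exact: continuous_xi. Qed.

Let measurable_p : measurable_fun `[0, t] p.
Proof. by apply: measurable_funTS; exact: continuous_measurable_fun. Qed.

Let integrable_p : mu.-integrable `[0, t] (EFin \o p).
Proof. exact/within_continuous_integrable/continuous_subspaceT. Qed.

Let continuous_halfwidth : {within `[0, t], continuous (fun s => (uhi s - ulo s) / 2)}.
Proof.
apply: within_continuousM; first exact: within_continuousB.
by move=> s; exact: cvg_cst.
Qed.

Let continuous_midpoint : {within `[0, t], continuous (fun s => (uhi s + ulo s) / 2)}.
Proof.
apply: within_continuousM; first exact: within_continuousD.
by move=> s; exact: cvg_cst.
Qed.

Lemma integrable_sgrM f : {within `[0, t], continuous f} ->
  mu.-integrable `[0, t] (EFin \o (fun s => Num.sg (p s) * f s)).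
Proof.
move=> cf; rewrite (_ : _ \o _ = (EFin \o (Num.sg \o p)) \* (EFin \o f))%E//.
apply: integrableMr => //.
- apply: measurableT_comp; first exact: measurable_sgr.
  exact: measurable_p.
- by apply: (@le_bounded_on _ _ _ _ 1) => s _; exact: norm_sgr_le1.
- exact: within_continuous_integrable.
Qed.

Lemma integrable_bang_bang : mu.-integrable `[0, t] (EFin \o bang_bang).
Proof.
apply: integrable_EFinD => //; first exact: within_continuous_integrable.
exact: integrable_sgrM.
Qed.

Lemma dotv_endpointB u v : mu.-integrable `[0, t] (EFin \o u) ->
    mu.-integrable `[0, t] (EFin \o v) ->
  dotv eta (endpoint t x0 u) - dotv eta (endpoint t x0 v) =
  \int[mu]_(s in `[0, t]) ((u s - v s) * p s).
Proof.
move=> intu intv; rewrite !dotv_endpoint// opprD addrACA subrr add0r.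
have cp : {within `[0, t], continuous p} by exact: continuous_subspaceT.
rewrite -RintegralB//; [|exact: integrableM_continuous..].
by apply: eq_Rintegral => s _; rewrite mulrBl.
Qed.

Lemma control_integrable u : controls t ulo uhi u -> mu.-integrable `[0, t] (EFin \o u).
Proof. by move=> [/within_continuous_integrable]. Qed.

Lemma dotv_bang_bangB u : controls t ulo uhi u ->
  dotv eta (endpoint t x0 bang_bang) - dotv eta (endpoint t x0 u) =
  \int[mu]_(s in `[0, t]) (`|bang_bang s - u s| * `|p s|).
Proof.
move=> Xu; rewrite dotv_endpointB; first last.
- exact: control_integrable.
- exact: integrable_bang_bang.
apply: eq_Rintegral => s /[!inE]; rewrite /= in_itv => st.
by rewrite modulated_sgrB_weight// Xu.2.
Qed.

Lemma bang_bang_strongly_exposed : eta != 0 ->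
  strongly_exposes (dotv eta) X (endpoint t x0 bang_bang).
Proof.
move=> eta0 e e0; pose K := \sum_k xi n t k 0.
have K0 : 0 <= K by rewrite sumr_ge0// => k _; rewrite xi_ge0 ?ltW.
have [M M0 uM] := within_continuous_bounded (within_continuousB cuhi culo).
have K1 : 0 < K + 1 by rewrite ltr_wpDl.
have [del del0 delP] := @Rintegral_weighted_small _ _ _ mu _ p (measurable_itv _)
  (lebesgue_measure_segment_lty 0 t) measurable_p (switching_ae_neq0 t _ eta0)
  M (e / (K + 1)) M0 (divr_gt0 e0 K1) integrable_p.
exists del => // y; rewrite reach_setE// => -[u Xu <-].
rewrite dotv_bang_bangB// => gap.
have intu := control_integrable Xu; have intb := integrable_bang_bang.
apply: (le_trans (norm_endpointB_le x0 t0 intb intu)).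
apply: (@le_trans _ _ (K * (e / (K + 1)))); last first.
  by rewrite mulrCA ler_piMr ?(ltW e0)// ler_pdivrMr// mul1r lerDl.
apply: ler_wpM2l => //; apply: delP gap => [|s].
  apply: measurableT_comp => //; apply/measurable_EFinP.
  by apply: (measurable_int mu); exact: integrable_EFinB.
rewrite /= in_itv normr_ge0 /= => st.
have bang_u := norm_modulatedB_le (Xu.2 s st) (norm_sgr_le1 (p s)).
by rewrite (le_trans bang_u)// (le_trans (ler_norm _) (uM s st)).
Qed.

Definition smoothed_bang_bang e s :=
  modulated (ulo s) (uhi s) (p s / (`|p s| + e)).

Lemma smoothed_bang_bang_control e : 0 < e ->
    (forall s, 0 <= s <= t -> ulo s <= uhi s) ->
  controls t ulo uhi (smoothed_bang_bang e).
Proof.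
move=> e0 lohi; split=> [|s st]; last first.
  by rewrite modulated_itv ?lohi ?norm_smoothed_sgr_le1.
apply: within_continuousD => //; apply: within_continuousM => //.
apply: continuous_subspaceT => s.
apply: (@continuous_comp _ _ _ p (fun q => q / (`|q| + e))); first exact: continuous_p.
exact: continuous_smoothed_sgr.
Qed.

Lemma dotv_bang_bang_le_sup (c : R) : (forall s, 0 <= s <= t -> ulo s <= uhi s) ->
  (forall x, X x -> dotv eta x <= c) -> dotv eta (endpoint t x0 bang_bang) <= c.
Proof.
move=> lohi Xc; set w := \int[mu]_(s in `[0, t]) ((uhi s - ulo s) / 2).
have w1 : 0 < `|w| + 1 by rewrite ltr_wpDl.
apply/ler_addgt0Pr => e e0; pose d := e / (`|w| + 1).
have d0 : 0 < d by rewrite divr_gt0.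
have Xu := smoothed_bang_bang_control d0 lohi; set u := smoothed_bang_bang d in Xu.
have intb := integrable_bang_bang; have intu := control_integrable Xu.
have uc : dotv eta (endpoint t x0 u) <= c by apply: Xc; rewrite reach_setE//; exists u.
rewrite -lerBlDl (le_trans (lerB (lexx _) uc))// dotv_endpointB//.
apply: (@le_trans _ _ (d * w)).
  have inth := within_continuous_integrable continuous_halfwidth.
  rewrite -RintegralZl//; apply: le_Rintegral => // [||s].
  - apply: integrableM_continuous;
    [exact: integrable_EFinB|exact: continuous_subspaceT].
  - exact: integrable_EFinZl.
  - by rewrite /= in_itv => /lohi lh; exact: modulated_smoothed_sgr_le.
rewrite /d mulrAC ler_pdivrMr// ler_pM2l//.
by rewrite (le_trans (ler_norm _))// lerDl.
Qed.

Lemma supported_boundary_bang_bang (xb : 'cV[R]_n.+1) :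
  eta != 0 -> closure X xb ->
  (forall x, X x -> dotv eta x <= dotv eta xb) -> xb = endpoint t x0 bang_bang.
Proof.
move=> eta0 clxb supp.
apply: (strongly_exposes_unique (bang_bang_strongly_exposed eta0) _ clxb).
  by apply: continuous_dotv => k; exact: coord_continuous.
apply: dotv_bang_bang_le_sup => // s st.
have [x [+ _]] := clxb setT filterT; rewrite reach_setE//.
move=> -[u [_ /(_ s st)/andP[lu uu]] _].
exact: le_trans lu uu.
Qed.

Section Switching.
Variables (sg : 'I_n -> R) (e : R).
Local Notation sigma := (sigext t sg).
Hypothesis wsg : weyl t sg.
Hypothesis psg : forall i s, (i <= n)%N -> sigma i < s < sigma i.+1 ->
  Num.sg (p s) = e * (-1) ^+ i.

Lemma Rintegral_sgr_switching f : {within `[0, t], continuous f} ->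
  \int[mu]_(s in `[0, t]) (Num.sg (p s) * f s) =
  e * \sum_(i < n.+1) (-1) ^+ i * \int[mu]_(s in `[sigma i, sigma i.+1]) f s.
Proof.
move=> cf; have t_ge0 := ltW t0; have intsf := integrable_sgrM cf.
have sigma_last : sigma n.+1 = t by exact: sigext_geq.
rewrite -{1}sigma_last -(Rintegral_partition (sigext_homo t_ge0 wsg)) ?sigma_last//.
rewrite mulr_sumr; apply: eq_bigr => i _.
have sub : `[sigma i, sigma i.+1] `<=` `[0, t].
  have /andP[i0 _] := sigext_itv t_ge0 wsg i.
  have /andP[_ it] := sigext_itv t_ge0 wsg i.+1.
  by apply: subset_itv; rewrite bnd_simp.
have intf : mu.-integrable `[sigma i, sigma i.+1] (EFin \o f).
  by apply: integrableS (within_continuous_integrable cf).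
rewrite mulrA -RintegralZl//; apply: eq_Rintegral_oo.
- exact: integrableS intsf.
- exact: integrable_EFinZl.
- by move=> s; rewrite in_itv/= => /psg ->//; rewrite -ltnS.
Qed.

Lemma endpoint_bang_bang :
  endpoint t x0 bang_bang =
  chi t x0 + Rintv 0 t (fun s => ((uhi s + ulo s) / 2) *: xi n (t - s)) +
  e *: \sum_(i < n.+1) ((-1) ^+ i *: Rintv (sigma i) (sigma i.+1)
    (fun s => ((uhi s - ulo s) / 2) *: xi n (t - s))).
Proof.
apply/colP => k; rewrite endpointE [RHS]mxE [X in _ = X + _]mxE.
rewrite [X in _ = _ + X]mxE summxE Rintv_xiE -addrA; congr (_ + _).
have intm := within_continuous_integrable continuous_midpoint.
have ints := integrable_sgrM continuous_halfwidth.
under [in RHS]eq_bigr do rewrite mxE Rintv_xiE.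
rewrite -Rintegral_sgr_switching; last first.
  by apply: within_continuousM => //; exact/continuous_subspaceT/continuous_xi.
under [X in _ = _ + X]eq_Rintegral do rewrite mulrA.
rewrite -RintegralD//; [|exact: integrableM_xi..].
by apply: eq_Rintegral => s _; rewrite /bang_bang /modulated mulrDl.
Qed.

End Switching.

End BangBang.

(** * Continuity of the input range *)

Section EntirePowerSeries.
Variables (R : realType) (c : R^nat).
Hypothesis cvg_c : forall x : R, cvgn (pseries c x).

Lemma is_cvg_pseries_diffs (x : R) : cvgn (pseries (pseries_diffs c) x).
Proof.
pose y : R := 4 * (`|x| + 1); have y0 : 0 < y by rewrite mulr_gt0// ltr_wpDl.
have [K [Kreal Kc]] := cvg_series_bounded (@cvg_c y).
have {}Kc k : `|c k * y ^+ k| <= `|K| + 1.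
  by apply: Kc => //; rewrite ltr_pwDr// ler_norm.
apply: normed_cvg; apply: (@series_le_cvg _ _ (geometric ((`|K| + 1) / y) 2^-1)) => //.
- by move=> k; exact: normr_ge0.
- by move=> k; rewrite /geometric /= mulr_ge0// divr_ge0 ?ltW// addr_ge0.
- move=> k; rewrite /geometric /= /pseries_diffs !normrM normr_nat normrX mulrAC.
  have xk : k.+1%:R * `|x| ^+ k <= (y / 2) ^+ k.
    apply: (@le_trans _ _ ((2 * `|x|) ^+ k)).
      by rewrite exprMn ler_wpM2r ?exprn_ge0// -natrX ler_nat ltn_expl.
    by rewrite lerXn2r ?nnegrE ?mulr_ge0// /y; have := normr_ge0 x; lra.
  apply: (le_trans (ler_wpM2r (normr_ge0 _) xk)).
  rewrite exprMn -mulrA [_ * `|c _|]mulrC mulrA ler_wpM2r ?exprn_ge0//.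
  rewrite ler_pdivlMr// mulrC mulrA -exprS mulrC.
  by have := Kc k.+1; rewrite normrM (ger0_norm (exprn_ge0 _ (ltW y0))).
- by apply: is_cvg_geometric_series; rewrite ger0_norm// invf_lt1 ?ltr1n.
Qed.

End EntirePowerSeries.

Lemma continuous_pseries (R : realType) (c : R^nat) :
    (forall x : R, cvgn (pseries c x)) ->
  continuous (fun x => limn (pseries c x)).
Proof.
move=> cvg_c x; apply/differentiable_continuous/derivable1_diffP.
have cvg_d := is_cvg_pseries_diffs cvg_c; have cvg_dd := is_cvg_pseries_diffs cvg_d.
have [|//] := pseries_snd_diffs (cvg_c (`|x| + 1)) (cvg_d _) (cvg_dd _) (x := x).
by rewrite [ltRHS]ger0_norm ?addr_ge0// ltrDl.
Qed.

Section MatrixExponential.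
Variables (R : realType) (n : nat) (A : 'M[R]_n.+1).

Lemma norm_mxX_entry_le :
  exists2 C : R, 0 <= C & forall k i j, `|(A ^+ k) i j| <= C ^+ k.
Proof.
pose B := \sum_i \sum_j `|A i j|.
have B0 : 0 <= B by rewrite sumr_ge0// => i _; rewrite sumr_ge0.
have AB i j : `|A i j| <= B.
  rewrite /B (bigD1 i)//= (bigD1 j)//= -addrA lerDl addr_ge0 ?sumr_ge0// => k _.
  by rewrite sumr_ge0.
exists (n.+1%:R * B); first by rewrite mulr_ge0.
elim=> [|k IH] i j; first by rewrite !expr0 mxE; case: eqP; rewrite ?normr1 ?normr0.
rewrite exprS mxE exprS; apply: (le_trans (ler_norm_sum _ _ _)).
apply: (@le_trans _ _ (\sum_(l < n.+1) B * (n.+1%:R * B) ^+ k)).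
  by apply: ler_sum => l _; rewrite normrM ler_pM.
by rewrite sumr_const card_ord -[leLHS]mulr_natl mulrA.
Qed.

Lemma is_cvg_expmx_entry i j (x : R) :
    cvgn (pseries (fun k => (A ^+ k) i j / k`!%:R) x).
Proof.
have [C C0 AC] := norm_mxX_entry_le; apply: normed_cvg.
apply: (@series_le_cvg _ _ (exp_coeff (C * `|x|))) => [k|k|k|].
- exact: normr_ge0.
- by rewrite /exp_coeff /= divr_ge0 ?exprn_ge0 ?mulr_ge0.
- rewrite /exp_coeff /= !normrM normfV normr_nat normrX exprMn mulrAC.
  by rewrite !ler_wpM2r ?exprn_ge0.
- exact: is_cvg_series_exp_coeff.
Qed.

Lemma continuous_expmx_entry i j : continuous (fun r : R => expmx (r *: A) i j).
Proof.
rewrite (_ : (fun r => _) = fun r => limn (pseries (fun k => (A ^+ k) i j / k`!%:R) r)).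
  exact/continuous_pseries/is_cvg_expmx_entry.
apply/funext => r; rewrite mxE /pseries; congr (limn (series _)).
by apply/funext => k; rewrite exprZn mxE -mulrA mulrC.
Qed.

Lemma continuous_dotv_expmx (c w : 'cV[R]_n.+1) :
  continuous (fun r : R => dotv c (expmx (r *: A) *m w)).
Proof.
apply: continuous_dotv => k; under eq_fun do rewrite mxE.
apply: continuous_sum => j x; apply: cvgM; last exact: cvg_cst.
exact: continuous_expmx_entry.
Qed.

End MatrixExponential.

Section Clamp.
Variables (R : realType) (a b : R).
Hypothesis ab : a <= b.

Definition clamp (r : R) : R := Num.max a (Num.min r b).

Lemma clamp_itv r : a <= clamp r <= b.
Proof. by rewrite /clamp le_max lexx /= ge_max ab ge_min lexx orbT. Qed.

Lemma clamp_id r : a <= r <= b -> clamp r = r.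
Proof. by rewrite /clamp => /andP[ar rb]; rewrite min_l// max_r. Qed.

Lemma continuous_clamp : continuous clamp.
Proof.
move=> r; apply: (@continuous_max R _ (cst a) (fun r => Num.min r b)).
  exact: cvg_cst.
by apply: (@continuous_min R _ id (cst b)); [exact: cvg_id|exact: cvg_cst].
Qed.

Lemma continuous_comp_clamp (f : R -> R) : {within `[a, b], continuous f} ->
  continuous (f \o clamp).
Proof.
move=> /subspace_continuousP cf x.
have clampab r : `[a, b]%classic (clamp r) by rewrite /= in_itv/= clamp_itv.
apply: (@cvg_comp _ _ _ clamp f _ _ _ _ (cf _ (clampab x))) => U /= Uf.
have : nbhs x (fun r => `[a, b]%classic (clamp r) -> U (clamp r)) :=
  continuous_clamp Uf.
by apply: filterS => r; apply.
Qed.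

Lemma within_continuous_reflect (f : R -> R) : {within `[a, b], continuous f} ->
  {within `[a, b], continuous (fun x => f (a + b - x))}.
Proof.
move=> /continuous_comp_clamp cf.
apply: (@subspace_eq_continuous _ _ _ (fun x => f (clamp (a + b - x)))).
  by move=> x /[!inE] /=; rewrite in_itv/= => /andP[ax xb]; rewrite clamp_id//; lra.
apply: continuous_subspaceT => x.
apply: (@continuous_comp _ _ _ (fun x => a + b - x) (f \o clamp)); last exact: cf.
by apply: cvgB; [exact: cvg_cst|exact: cvg_id].
Qed.

End Clamp.

Lemma klipschitz_within_continuous (R : realType) (k : R) (A : set R) (f : R -> R) :
  k.-lipschitz_A f -> {within A, continuous f}.
Proof.
move=> flip; apply/subspace_continuousP => x Ax; apply/cvgrPdist_le => e e0.
have k1 : 0 < `|k| + 1 by rewrite ltr_wpDl.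
rewrite near_withinE; near=> y => Ay.
have xy : `|x - y| <= e / (`|k| + 1).
  by near: y; apply: (@cvgr_dist_le _ _ _ _ _ id x); rewrite ?divr_gt0//; exact: cvg_id.
apply: (le_trans (flip (x, y) (conj Ax Ay))) => /=.
apply: (@le_trans _ _ ((`|k| + 1) * `|x - y|)).
  by rewrite ler_wpM2r// (le_trans (ler_norm _))// lerDl.
by rewrite mulrC -ler_pdivlMr.
Unshelve. all: by end_near. Qed.

Lemma klipschitz_Rintegral (R : realType) (a b k : R) (f : R -> R) :
  (@lebesgue_measure R).-integrable `[a, b] (EFin \o f) ->
  (forall x, a <= x <= b -> `|f x| <= k) ->
  k.-lipschitz_(`[a, b]) (fun x => \int[@lebesgue_measure R]_(y in `[a, x]) f y).
Proof.
move=> intf fk [x y]; wlog xy : x y / x <= y.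
  move=> sym [xab yab]; have [xy|/ltW yx] := leP x y; first exact: sym.
  by have := sym y x yx (conj yab xab); rewrite /= distrC [`|y - x|]distrC.
rewrite /= !in_itv/= => -[/andP[ax xb] /andP[ay yb]].
have intxy : (@lebesgue_measure R).-integrable `[x, y] (EFin \o f).
  by apply: integrableS intf => //; apply: subset_itv; rewrite bnd_simp.
rewrite (@Rintegral_itv_cat _ a x y)//; last first.
  by apply: integrableS intf => //; apply: subset_itvl; rewrite bnd_simp.
rewrite opprD addrA subrr sub0r normrN (distrC x) (ger0_norm (_ : 0 <= y - x))
  ?subr_ge0//.
apply: (le_trans (le_normr_Rintegral _ intxy)) => //.
have -> : k * (y - x) = \int[@lebesgue_measure R]_(_ in `[x, y]) k.
  rewrite Rintegral_cst//= lebesgue_measure_itv /= lte_fin.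
  by move: xy; rewrite le_eqVlt => /predU1P[->|->//]; rewrite ltxx subrr.
apply: le_Rintegral => //; first exact: integrable_norm.
  by apply: within_continuous_integrable => ?; exact: cvg_cst.
by move=> z; rewrite /= in_itv/= => /andP[xz zy];
  rewrite fk// (le_trans ax)// (le_trans zy).
Qed.

Lemma klipschitz_sup_image (R : realType) (T : Type) (W : set T) (F : R -> T -> R)
    (A : set R) (k : R) : W !=set0 -> (forall w, W w -> k.-lipschitz_A (F^~ w)) ->
  (forall s, A s -> has_ubound (F s @` W)) -> k.-lipschitz_A (fun s => sup (F s @` W)).
Proof.
move=> W0 Flip Fub; have le_sup s r : A s -> A r ->
    sup (F s @` W) <= sup (F r @` W) + k * `|s - r|.
  move=> As Ar; apply: ge_sup; first by have [w Ww] := W0; exists (F s w), w.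
  move=> _ [w Ww <-]; have /= := Flip w Ww (s, r) (conj As Ar).
  rewrite ler_norml => /andP[_ Fsr].
  have : F r w <= sup (F r @` W) by apply: sup_ubound; [exact: Fub|exists w].
  lra.
move=> [s r] [/= As Ar]; have := le_sup _ _ As Ar; have := le_sup _ _ Ar As.
by rewrite (distrC r) ler_norml => ? ?; apply/andP; split; lra.
Qed.

Lemma klipschitz_inf_image (R : realType) (T : Type) (W : set T) (F : R -> T -> R)
    (A : set R) (k : R) : W !=set0 -> (forall w, W w -> k.-lipschitz_A (F^~ w)) ->
  (forall s, A s -> has_lbound (F s @` W)) -> k.-lipschitz_A (fun s => inf (F s @` W)).
Proof.
move=> W0 Flip Flb [s r] Asr; rewrite /= /inf !image_comp -opprD normrN.
apply: (klipschitz_sup_image (F := fun s w => - F s w) W0 _ _ Asr)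
  => [w Ww sr Asr'|q Aq].
  by rewrite /= -opprD normrN; exact: Flip Asr'.
have [m Fm] := Flb q Aq; exists (- m) => _ [w Ww <-].
by rewrite lerN2; apply: Fm; exists w.
Qed.

Section InputRange.
Variables (R : realType) (n : nat) (A : 'M[R]_n.+1) (vmin vmax t : R).
Hypotheses (vv : vmin <= vmax) (t0 : 0 <= t).
Local Notation mu := (@lebesgue_measure R).

Definition impulse_response (r : R) : R :=
  dotv (ccoef A) (expmx (r *: Acon A) *m bcon R n).

(* [Ifun A s v] in terms of [w r = v (s - r)]: only the upper bound depends on [s]. *)
Definition reflected_Ifun (s : R) (w : R -> R) : R :=
  w 0 - \int[mu]_(r in `[0, s]) (impulse_response r * w r).

Lemma continuous_impulse_response : continuous impulse_response.
Proof. exact: continuous_dotv_expmx. Qed.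

Lemma eq_reflected_Ifun (s : R) (v w : R -> R) : 0 <= s ->
  (forall r, 0 <= r <= s -> v r = w r) -> reflected_Ifun s v = reflected_Ifun s w.
Proof.
move=> s0 vw; rewrite /reflected_Ifun vw ?lexx//; congr (_ - _).
by apply: eq_Rintegral => r /[!inE]; rewrite /= in_itv => rs; rewrite vw.
Qed.

Lemma Ifun_reflect (s : R) (v : R -> R) : 0 <= s -> {within `[0, s], continuous v} ->
  Ifun A s v = reflected_Ifun s (fun r => v (s - r)).
Proof.
move=> s0 cv; rewrite /Ifun /reflected_Ifun subr0; congr (_ - _).
rewrite -[RHS]Rintegral_reflect//.
  by apply: eq_Rintegral => r _; rewrite add0r subKr.
apply: within_continuousM; first exact/continuous_subspaceT/continuous_impulse_response.
by have := within_continuous_reflect s0 cv; rewrite add0r.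
Qed.

Lemma Iset_reflect (s : R) : 0 <= s <= t ->
  Iset A vmin vmax s = reflected_Ifun s @` admissible vmin vmax t.
Proof.
move=> /andP[s0 st]; apply/seteqP; split=> [_ [v [cv bv] <-]|_ [w [cw bw] <-]].
- have cvs : {within `[0, s], continuous (fun r => v (s - r))}.
    by have := within_continuous_reflect s0 cv; rewrite add0r.
  exists ((fun r => v (s - r)) \o clamp 0 s).
    split=> [|r _ /=]; first exact/continuous_subspaceT/continuous_comp_clamp.
    by apply: bv; have := clamp_itv s0 r; lra.
  rewrite Ifun_reflect//; apply: eq_reflected_Ifun => // r rs /=.
  by rewrite clamp_id.
- have cws : {within `[0, s], continuous w}.
    by apply: continuous_subspaceW cw; apply: subset_itvl; rewrite bnd_simp.
  have cwr : {within `[0, s], continuous (fun r => w (s - r))}.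
    by have := within_continuous_reflect s0 cws; rewrite add0r.
  exists (fun r => w (s - r)); first by split=> // r rs; apply: bw; lra.
  rewrite Ifun_reflect//; apply: eq_reflected_Ifun => // r _.
  by rewrite subKr.
Qed.

Lemma admissible_neq0 : admissible vmin vmax t !=set0.
Proof. by exists (cst vmin); split=> [s|r _]; [exact: cvg_cst|rewrite lexx]. Qed.

Lemma norm_admissible_le w r : admissible vmin vmax t w -> 0 <= r <= t ->
  `|w r| <= `|vmin| + `|vmax|.
Proof.
move=> [_ /(_ r)+] rt => /(_ rt)/andP[lw wu]; rewrite ler_norml.
have := ler_norm vmax; have := ler_norm (- vmin); rewrite normrN.
have := normr_ge0 vmin; have := normr_ge0 vmax; lra.
Qed.

Lemma klipschitz_reflected_Ifun : exists2 L, 0 <= L &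
  forall w, admissible vmin vmax t w -> L.-lipschitz_(`[0, t]) (reflected_Ifun^~ w).
Proof.
have cg : {within `[0, t], continuous impulse_response}.
  exact/continuous_subspaceT/continuous_impulse_response.
have [G G0 gG] := within_continuous_bounded cg.
exists (G * (`|vmin| + `|vmax|)) => [|w Ww [s r] sr].
  by rewrite mulr_ge0 ?addr_ge0.
rewrite /= /reflected_Ifun opprD addrACA subrr add0r opprK addrC distrC.
apply: (klipschitz_Rintegral (f := fun x => impulse_response x * w x) _ _ sr)
  => [|x xt].
  by apply: within_continuous_integrable; apply: within_continuousM => //; exact: Ww.1.
by rewrite normrM ler_pM ?gG ?norm_admissible_le.
Qed.

Lemma reflected_Ifun_bounded : exists B, forall s w,
  0 <= s <= t -> admissible vmin vmax t w -> `|reflected_Ifun s w| <= B.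
Proof.
have [L L0 Jlip] := klipschitz_reflected_Ifun.
exists (L * t + (`|vmin| + `|vmax|)) => s w /andP[s0 st] Ww.
have J0 : reflected_Ifun 0 w = w 0.
  by rewrite /reflected_Ifun set_itv1 Rintegral_set1 subr0.
rewrite -(subrK (reflected_Ifun 0 w) (reflected_Ifun s w)) (le_trans (ler_normD _ _))//.
rewrite lerD// ?J0 ?norm_admissible_le ?lexx//; rewrite -J0.
have := Jlip w Ww (s, 0); rewrite /= !in_itv/= s0 st lexx t0 => /(_ (conj isT isT)).
by move=> /le_trans; apply; rewrite subr0 (ger0_norm s0) ler_wpM2l.
Qed.

Lemma continuous_Imin : {within `[0, t], continuous (Imin A vmin vmax)}.
Proof.
have [L _ Jlip] := klipschitz_reflected_Ifun; have [B JB] := reflected_Ifun_bounded.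
apply: (@subspace_eq_continuous _ _ _
    (fun s => inf (reflected_Ifun s @` admissible vmin vmax t))).
  by move=> s /[!inE]/=; rewrite in_itv/= => st;
    exact: (congr1 inf (esym (Iset_reflect st))).
apply: (@klipschitz_within_continuous _ L); apply: klipschitz_inf_image => //.
- exact: admissible_neq0.
- move=> s; rewrite /= in_itv/= => st; exists (- B) => _ [w Ww <-].
  by have := JB _ _ st Ww; rewrite ler_norml => /andP[].
Qed.

Lemma continuous_Imax : {within `[0, t], continuous (Imax A vmin vmax)}.
Proof.
have [L _ Jlip] := klipschitz_reflected_Ifun; have [B JB] := reflected_Ifun_bounded.
apply: (@subspace_eq_continuous _ _ _
    (fun s => sup (reflected_Ifun s @` admissible vmin vmax t))).
  by move=> s /[!inE]/=; rewrite in_itv/= => st;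
    exact: (congr1 sup (esym (Iset_reflect st))).
apply: (@klipschitz_within_continuous _ L); apply: klipschitz_sup_image => //.
- exact: admissible_neq0.
- move=> s; rewrite /= in_itv/= => st; exists B => _ [w Ww <-].
  by have := JB _ _ st Ww; rewrite ler_norml => /andP[].
Qed.

Variables (b z0 : 'cV[R]_n.+1).

Lemma continuous_umin : {within `[0, t], continuous (umin A b vmin vmax z0)}.
Proof.
apply: within_continuousD; last exact: continuous_Imin.
by apply: continuous_subspaceT => s; apply: cvgN; exact: continuous_dotv_expmx.
Qed.

Lemma continuous_umax : {within `[0, t], continuous (umax A b vmin vmax z0)}.
Proof.
apply: within_continuousD; last exact: continuous_Imax.
by apply: continuous_subspaceT => s; apply: cvgN; exact: continuous_dotv_expmx.
Qed.

End InputRange.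

Theorem theorem2 (R : realType) (n : nat) (A : 'M[R]_n.+1) (b : 'cV[R]_n.+1)
  (vmin vmax : R) (z0 : 'cV[R]_n.+1) (t : R) :
  controllable A b -> distinct_eigenvalues A ->
  vmin <= vmax -> 0 < t ->
  let x0 := Mmat A b *m z0 in
  let ulo := umin A b vmin vmax z0 in
  let uhi := umax A b vmin vmax z0 in
  let mu := fun s => (uhi s - ulo s) / 2 in
  let nu := fun s => (uhi s + ulo s) / 2 in
  forall xb : 'cV[R]_n.+1,
    boundary (reach_set ulo uhi t x0) xb ->
    exists (sg : 'I_n -> R) (eps : R),
      weyl t sg /\ (eps = 1 \/ eps = -1) /\
      xb = chi t x0 + Rintv 0 t (fun s => nu s *: xi n (t - s))
           + eps *: \sum_(i < n.+1)
               ((-1) ^+ i *: Rintv (sigext t sg i) (sigext t sg i.+1)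
                              (fun s => mu s *: xi n (t - s))).
Proof.
move=> _ _ vv t0 x0 ulo uhi mu nu xb [clxb nint]; have t_ge0 := ltW t0.
have culo : {within `[0, t], continuous ulo} by exact: continuous_umin.
have cuhi : {within `[0, t], continuous uhi} by exact: continuous_umax.
have cvxX : convex_set (reach_set ulo uhi t x0) by exact: convex_reach_set.
have [|eta eta0 supp] := supporting_hyperplane cvxX _ nint.
  by have [z [Xz _]] := clxb setT filterT; exists z.
have [p [p0 sp pE]] := switching_poly t eta0.
have [sg [e [wsg e1 psg]]] := poly_sgr_switching t_ge0 p0 sp.
exists sg, e; split=> //; split=> //.
rewrite -(endpoint_bang_bang (eta := eta) x0 t0 culo cuhi wsg) => [|i s i_n si].
  exact: supported_boundary_bang_bang.
by rewrite -pE; exact: psg.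
Qed.
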